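(* Let $G_m$ be a bounded Vilenkin group, let $f\in L_1(G_m)$, and let $T_n$ be the $T$ means associated with a non-increasing sequence $\{q_k:k\ge 0\}$ of non-negative numbers with $q_0>0$. Then $$T_nf\to f\quad\text{a.e., as } n\to\infty .$$
   Context: Notation: $\mathbb N_+=\{1,2,\dots\}$, $\mathbb N=\mathbb N_+\cup\{0\}$. Let $m=(m_0,m_1,\dots)$ be a sequence of integers $m_k\ge 2$ with $\sup_k m_k<\infty$ (bounded case). $Z_{m_k}=\{0,\dots,m_k-1\}$ is the additive group of integers modulo $m_k$ with the discrete topology, and $G_m=\prod_{k\ge 0}Z_{m_k}$ with the product topology and the product measure $\mu$ of the uniform measures $\mu_k(\{j\})=1/m_k$ (normalized Haar measure); ''a.e.'' refers to $\mu$. Elements are $x=(x_0,x_1,\dots)$ with $x_j\in Z_{m_j}$. Put $M_0=1$, $M_{k+1}=m_kM_k$; each $n\in\mathbb N$ is uniquely $n=\sum_{j\ge 0}n_jM_j$ with $n_j\in Z_{m_j}$, finitely many nonzero. Generalized Rademacher functions: $r_k(x)=\exp(2\pi i x_k/m_k)$. Vilenkin system: $\psi_n(x)=\prod_{k\ge 0}r_k^{n_k}(x)$, $n\in\mathbb N$. For $f\in L_1(G_m)$: $\widehat f(n)=\int_{G_m}f\overline{\psi}_n\,d\mu$, and $S_nf=\sum_{k=0}^{n-1}\widehat f(k)\psi_k$ for $n\in\mathbb N_+$, with $S_0f=0$. Given the sequence $\{q_k\}$, put $Q_n=\sum_{k=0}^{n-1}q_k$. The $T$ means are $T_nf=\frac1{Q_n}\sum_{k=0}^{n-1}q_kS_kf$,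 $n\in\mathbb N_+$.
   Formalization: The formal theorem additionally assumes that Q_n tends to infinity; without this the claim fails for f = 1, since T_n f = 1 - q_0/Q_n (for example q = (1,0,0,...) gives T_n f = 0 for all n). *)

(* Defs.v *)
From HB Require Import structures.
From mathcomp Require Import all_boot all_order all_algebra.
From mathcomp Require Import all_classical all_reals all_analysis.
From mathcomp Require Import complex.

Set Implicit Arguments.
Unset Strict Implicit.
Unset Printing Implicit Defensive.

Import Order.TTheory GRing.Theory Num.Theory.
Import numFieldNormedType.Exports.

Local Open Scope classical_set_scope.
Local Open Scope ring_scope.

(* ['Z_(m k)] is the integers modulo [m k] only when [1 < m k]; this is
   always assumed, as part of [bounded_vilenkin]. *)
Definition bounded_vilenkin (m : nat -> nat) : Prop :=
  (forall k, (1 < m k)%N) /\ (exists B : nat, forall k, (m k <= B)%N).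

Definition vilenkin_seq (m : nat -> nat) : Type := forall k : nat, 'Z_(m k).

HB.instance Definition _ (m : nat -> nat) :=
  Choice.copy (vilenkin_seq m) (forall k : nat, 'Z_(m k)).
HB.instance Definition _ (m : nat -> nat) :=
  isPointed.Build (vilenkin_seq m) (fun=> 0).

(* The Borel sigma-algebra of the countable product of the finite discrete
   groups ['Z_(m k)] is the one generated by the coordinate maps. *)
Definition coord_sets (m : nat -> nat) : set (set (vilenkin_seq m)) :=
  [set C | exists (k : nat) (A : {set 'Z_(m k)}), C = [set x | x k \in A]].

Definition vilenkin (m : nat -> nat) := g_sigma_algebraType (@coord_sets m).

Section VilenkinFourier.
Variables (R : realType) (m : nat -> nat).

Definition uniform_mass (k : nat) (A : {set 'Z_(m k)}) : R :=
  #|A|%:R / (m k)%:R.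

(* The product measure is the only probability measure with these values, the
   finite-dimensional rectangles being a pi-system generating the
   sigma-algebra. *)
Definition is_product_measure (mu : probability (vilenkin m) R) : Prop :=
  forall (n : nat) (A : forall k : nat, {set 'Z_(m k)}),
    mu [set x : vilenkin m | forall k, (k < n)%N -> x k \in A k] =
    (\prod_(k < n) uniform_mass (A k))%:E.

Definition M (k : nat) : nat := (\prod_(i < k) m i)%N.

Definition digit (n k : nat) : nat := ((n %/ M k) %% m k)%N.

Definition rademacher (k : nat) (x : vilenkin m) : R[i] :=
  let t := 2 * pi * (x k : nat)%:R / (m k)%:R in (cos t +i* sin t)%C.

(* As [n < 2 ^ n <= M n], the digits of [n] of index at least [n] vanish, so
   that this finite product is the full product over all [k]. *)
Definition psi (n : nat) (x : vilenkin m) : R[i] :=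
  \prod_(k < n) rademacher k x ^+ digit n k.

Variable mu : probability (vilenkin m) R.

Definition L1 (f : vilenkin m -> R[i]) : Prop :=
  mu.-integrable setT (fun x => (complex.Re (f x))%:E) /\
  mu.-integrable setT (fun x => (complex.Im (f x))%:E).

Definition cintegral (f : vilenkin m -> R[i]) : R[i] :=
  ((\int[mu]_x complex.Re (f x)) +i* (\int[mu]_x complex.Im (f x)))%C.

Definition fourier_coef (f : vilenkin m -> R[i]) (n : nat) : R[i] :=
  cintegral (fun x => f x * (psi n x)^*).

Definition partial_sum (f : vilenkin m -> R[i]) (n : nat) (x : vilenkin m) :
    R[i] :=
  \sum_(k < n) fourier_coef f k * psi k x.

Definition Q (q : nat -> R) (n : nat) : R := \sum_(k < n) q k.

Definition T_mean (q : nat -> R) (f : vilenkin m -> R[i]) (n : nat)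
    (x : vilenkin m) : R[i] :=
  ((Q q n)^-1)%:C%C * \sum_(k < n) (q k)%:C%C * partial_sum f k x.

End VilenkinFourier.

(* Main.v *)
Require Import Defs.
From mathcomp Require Import all_boot all_order all_algebra.
From mathcomp Require Import all_classical all_reals all_analysis.
From mathcomp Require Import measurable_realfun complex.
From mathcomp Require Import ring lra zify.

Import Order.TTheory GRing.Theory Num.Theory.
Import numFieldNormedType.Exports.

Local Open Scope classical_set_scope.
Local Open Scope ring_scope.

Set Implicit Arguments.
Unset Strict Implicit.
Unset Printing Implicit Defensive.

(** Abel summation against the non-increasing weights [q] turns a bound
    [|S_0 f + ... + S_(n-1) f| <= c n], valid for all [n] at a point, into
    [|T_n f| <= c] for all [n] at that point ([normc_T_mean_le]).  The theorem
    thus reduces to a weak-type (1,1) inequality for Fejer sums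
    ([fejer_maximal_inequality]) and to convergence for the indicators of
    rectangles: the functions whose means converge almost everywhere form a
    linear space that the weak-type inequality makes closed in [L1] ([ae_cvg_closed]), and Dynkin's theorem and
    simple functions lead from rectangles to all of [L1] ([L1_ae_cvg]).

    The Fejer kernel at [(x, t)] depends only on the phases
    [z_l = r_l(x) r_l(t)^*], which are [m_l]-th roots of unity, equal to 1
    exactly when [x_l = t_l].  Expanding [n] in the mixed radix [M] bounds it by
    the sum over [M_k <= n] of the kernels [majorant], in which the pair
    [s <= k] contributes [M_s M_k] on the set where [x] and [t] agree below [k]
    except perhaps at [s] ([normc_fejer_le]).

    For a fixed gap [j = k - s], the cells obtained by ignoring the coordinate
    [k - j] below level [k] form, along each residue class of [k] modulo
    [j + 1], a refining sequence of partitions.  Doob's inequality then gives a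
    weak-type bound with constant [j + 1] for the averages over these cells
    ([cell_maximal_inequality]).  The weight [M_s / M_k <= 2^-j] beats this
    linear growth, so the bounds can be summed over [j].

    For the indicator [g] of a rectangle of depth [N], the sums [S_(M_k) g]
    equal [g] as soon as [k >= N].  The sum of the squared coefficients below
    [M_k] is then independent of [k >= N], so that the coefficients of index at
    least [M_N] vanish and [S_j g = g] for all [j >= M_N]
    ([fourier_coef_rectangle]). Since [Q_n] tends to infinity, [T_n g] tends
    to [g] everywhere. *)

(** * Complex moduli with real values *)

Notation normc := ComplexField.Normc.normc.

Section Normc.
Variable R : realType.
Implicit Types z w : R[i].

Lemma normcE z : (normc z)%:C%C = `|z|.
Proof. by case: z. Qed.

Lemma normc_ge0 z : 0 <= normc z.
Proof. by rewrite -ler0c normcE. Qed.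

Lemma normcD z w : normc (z + w) <= normc z + normc w.
Proof. by rewrite -lecR rmorphD /= !normcE ler_normD. Qed.

Lemma normcM z w : normc (z * w) = normc z * normc w.
Proof. exact: ComplexField.Normc.normcM. Qed.

Lemma normc_sum (I : Type) (s : seq I) (P : pred I) (F : I -> R[i]) :
  normc (\sum_(i <- s | P i) F i) <= \sum_(i <- s | P i) normc (F i).
Proof.
rewrite -lecR rmorph_sum /= normcE.
exact: ler_norm_sum.
Qed.

Lemma normcX z n : normc (z ^+ n) = normc z ^+ n.
Proof. by apply: complexI; rewrite normcE normrX rmorphXn /= normcE. Qed.

Lemma normc_real (r : R) : normc r%:C%C = `|r|.
Proof. by rewrite /= expr0n /= addr0 sqrtr_sqr. Qed.

Lemma normc_nat n : normc (n%:R : R[i]) = n%:R.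
Proof. by apply: complexI; rewrite normcE normr_nat rmorph_nat. Qed.

Lemma normcN z : normc (- z) = normc z.
Proof. by apply: complexI; rewrite !normcE normrN. Qed.

Lemma normc_le_ReIm z : normc z <= `|complex.Re z| + `|complex.Im z|.
Proof.
rewrite {1}[z]complexE (le_trans (normcD _ _)) // normcM !normc_real.
by rewrite lerD2l /= expr0n expr1n /= add0r sqrtr1 mul1r.
Qed.

Lemma Re_le_normc z : `|complex.Re z| <= normc z.
Proof. by rewrite -lecR normcE normc_ge_Re. Qed.

Lemma Im_le_normc z : `|complex.Im z| <= normc z.
Proof.
by case: z => a b /=; rewrite -sqrtr_sqr ler_wsqrtr // lerDr sqr_ge0.
Qed.

End Normc.

Lemma sum_root1 (F : fieldType) (z : F) (n : nat) :
  z ^+ n = 1 -> \sum_(i < n) z ^+ i = n%:R * (z == 1)%:R.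
Proof.
move=> zn; have [->|z1] := eqVneq z 1.
  by under eq_bigr do rewrite expr1n; rewrite sumr_const card_ord mulr1.
apply/eqP; rewrite mulr0 -(mulrI_eq0 _ (@mulfI _ (z - 1) _)) ?subr_eq0 //.
by rewrite -subrX1 zn subrr.
Qed.

(** * Mixed radix expansions *)

Section Radix.
Variable m : nat -> nat.
Hypothesis m_gt1 : forall k, (1 < m k)%N.
Implicit Types k l n a b : nat.

Lemma MS k : M m k.+1 = (m k * M m k)%N.
Proof. by rewrite /M big_ord_recr /= mulnC. Qed.

Lemma M_gt0 k : (0 < M m k)%N.
Proof. by apply: prodn_gt0 => i; apply: ltnW. Qed.

Lemma ltn_M n : (n < M m n)%N.
Proof.
elim: n => [|n IH]; first by rewrite /M big_ord0.
by rewrite MS (leq_trans _ (leq_mul (m_gt1 n) IH)) // mul2n -addnn addSn ltnS leq_addl.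
Qed.

Lemma M_dvd k l : (k <= l)%N -> (M m k %| M m l)%N.
Proof.
by move=> /subnK <-; elim: (l - k)%N => // d IH; rewrite addSn MS dvdn_mull.
Qed.

Lemma leq_M k l : (k <= l)%N -> (M m k <= M m l)%N.
Proof. by move=> kl; rewrite dvdn_leq ?M_gt0 ?M_dvd. Qed.

Lemma M_double k l : (2 ^ l * M m k <= M m (k + l))%N.
Proof.
elim: l => [|l IH]; first by rewrite addn0 mul1n.
by rewrite addnS MS expnS -mulnA leq_mul.
Qed.

Lemma digit_eq0 n k l : (n < M m k)%N -> (k <= l)%N -> digit m n l = 0%N.
Proof.
by move=> nk kl; rewrite /digit divn_small ?mod0n // (leq_trans nk) ?leq_M.
Qed.

Lemma digit_top a b k : (a < m k)%N -> (b < M m k)%N ->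
  digit m (a * M m k + b) k = a.
Proof.
move=> ak bk.
by rewrite /digit divnMDl ?M_gt0 // (divn_small bk) addn0 modn_small.
Qed.

Lemma digit_low a b k l : (l < k)%N -> digit m (a * M m k + b) l = digit m b l.
Proof.
move=> /M_dvd /dvdnP[c ->]; rewrite /digit MS !mulnA.
by rewrite divnMDl ?M_gt0 // modnMDl.
Qed.

End Radix.

(** * Dirichlet and Fejer kernels *)

Section Kernel.
Variables (R : realType) (m : nat -> nat) (B : nat).
Hypothesis m_gt1 : forall k, (1 < m k)%N.
Hypothesis m_leB : forall k, (m k <= B)%N.
Implicit Types (z : nat -> R[i]) (k l n a b : nat).

(** The value of the [n]-th Vilenkin function when the Rademacher functions
    take the values [z]. *)
Definition digit_monomial z n : R[i] := \prod_(k < n) z k ^+ digit m n k.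

Definition dirichlet z n : R[i] := \sum_(k < n) digit_monomial z k.

(** This is [n] times the Fejer kernel of order [n]. *)
Definition fejer z n : R[i] := \sum_(k < n) dirichlet z k.

Lemma digit_monomialE z n k : (n < M m k)%N ->
  digit_monomial z n = \prod_(l < k) z l ^+ digit m n l.
Proof.
have widen i j : (n < M m i)%N -> (i <= j)%N ->
    \prod_(l < i) z l ^+ digit m n l = \prod_(l < j) z l ^+ digit m n l.
  move=> ni ij; rewrite -(subnKC ij) big_split_ord /= [X in _ * X]big1 ?mulr1 //.
  by move=> l _; rewrite (digit_eq0 m_gt1 ni) ?expr0 // leq_addr.
move=> nk; rewrite /digit_monomial (widen _ (maxn n k)) ?leq_maxl ?ltn_M //.
by rewrite -(widen k) ?leq_maxr.
Qed.

Lemma digit_monomial_split z a b k : (a < m k)%N -> (b < M m k)%N ->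
  digit_monomial z (a * M m k + b) = z k ^+ a * digit_monomial z b.
Proof.
move=> ak bk; rewrite (@digit_monomialE _ _ k.+1); last first.
  by rewrite MS (leq_trans _ (leq_mul ak (leqnn _))) // mulSn addnC ltn_add2r.
rewrite big_ord_recr /= digit_top // mulrC; congr (_ * _).
rewrite (digit_monomialE _ bk); apply: eq_bigr => l _.
by rewrite digit_low.
Qed.

Lemma dirichletD z a n k : (a < m k)%N -> (n <= M m k)%N ->
  dirichlet z (a * M m k + n) =
    dirichlet z (a * M m k) + z k ^+ a * dirichlet z n.
Proof.
move=> ak nk; rewrite /dirichlet big_split_ord /=; congr (_ + _).
rewrite mulr_sumr; apply: eq_bigr => b _.
by rewrite digit_monomial_split // (leq_trans _ nk).
Qed.

Lemma dirichlet_mul z a k : (a <= m k)%N ->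
  dirichlet z (a * M m k) = dirichlet z (M m k) * \sum_(b < a) z k ^+ b.
Proof.
elim: a => [_|a IH ak]; first by rewrite mul0n /dirichlet !big_ord0 mulr0.
rewrite mulSnr dirichletD // IH ?(ltnW ak) // big_ord_recr /= mulrDr.
by rewrite [X in _ + X]mulrC.
Qed.

Lemma fejerD z a n k : (a < m k)%N -> (n <= M m k)%N ->
  fejer z (a * M m k + n) =
    fejer z (a * M m k) + n%:R * dirichlet z (a * M m k) + z k ^+ a * fejer z n.
Proof.
move=> ak nk; rewrite /fejer big_split_ord /= -addrA; congr (_ + _).
under eq_bigr => b _ do rewrite dirichletD // ?(leq_trans (ltnW (ltn_ord b)) nk) //.
by rewrite big_split /= sumr_const card_ord mulr_natl mulr_sumr.
Qed.

Lemma fejer_mul z a k : (a <= m k)%N ->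
  fejer z (a * M m k) =
    (M m k)%:R * dirichlet z (M m k) * (\sum_(b < a) \sum_(c < b) z k ^+ c) +
    fejer z (M m k) * \sum_(b < a) z k ^+ b.
Proof.
elim: a => [_|a IH ak].
  by rewrite mul0n /fejer !big_ord0 !mulr0 addr0.
rewrite mulSnr fejerD // IH ?(ltnW ak) // dirichlet_mul ?(ltnW ak) //.
by rewrite !big_ord_recr /=; ring.
Qed.

Definition agree (P : pred nat) k s : bool :=
  [forall l : 'I_k, (l != s :> nat) ==> P l].

Lemma agreeP (P : pred nat) k s :
  reflect (forall l, (l < k)%N -> l != s -> P l) (agree P k s).
Proof.
apply: (iffP forallP) => [H l lk ls|H l]; last by apply/implyP/H.
by have /implyP := H (Ordinal lk); apply.
Qed.

Lemma agree_eq (P P' : pred nat) k s : P =1 P' -> agree P k s = agree P' k s.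
Proof. by move=> PP; apply: eq_forallb => l; rewrite PP. Qed.

(** Up to a constant, a positive kernel that dominates [fejer] at [M_k]; [P l]
    stands for the equality of the two points at the coordinate [l]. *)
Definition majorant (P : pred nat) k : R :=
  \sum_(s < k.+1) (M m s * M m k)%:R * (agree P k s)%:R.

Lemma majorant_ge0 P k : 0 <= majorant P k.
Proof. by apply: sumr_ge0 => s _; rewrite mulr_ge0. Qed.

(** Each factor [1 + z_l + ... + z_l^(m_l - 1)] is [m_l] or 0. *)
Lemma dirichlet_M z k : (forall l, z l ^+ m l = 1) ->
  dirichlet z (M m k) = (M m k)%:R * (agree (fun l => z l == 1) k k)%:R.
Proof.
move=> zm; elim: k => [|k IH].
  rewrite /dirichlet /M big_ord0 big_ord1 /digit_monomial big_ord0 mul1r.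
  by rewrite (introT (agreeP _ _ _)).
rewrite MS dirichlet_mul // IH sum_root1 // natrM.
suff -> : agree (fun l => z l == 1) k.+1 k.+1 =
    agree (fun l => z l == 1) k k && (z k == 1).
  by rewrite -mulnb natrM; ring.
apply/agreeP/andP => [H|[/agreeP H zk] l].
  split; last by apply: H; rewrite // neq_ltn ltnSn.
  by apply/agreeP => l lk _; apply: H; rewrite ?neq_ltn ltnS // ltnW // .
rewrite ltnS leq_eqVlt => /predU1P[->//|lk] _.
by apply: H => //; rewrite neq_ltn lk.
Qed.

(** The recursive inequality that mirrors [fejer_mul] for [a = m_k], where the
    last factor of [fejer_mul] vanishes unless [z_k = 1]. *)
Lemma le_majorantS (P : pred nat) k :
  (M m k * M m k)%:R * (agree P k k)%:R + (m k * P k)%:R * majorant P k <=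
  majorant P k.+1.
Proof.
rewrite {2}/majorant big_ord_recr /= [majorant P k]/majorant big_ord_recr /=.
rewrite big_ord_recr /= mulrDr addrCA -[leRHS]addrA.
have agreeS s : P k -> agree P k s -> agree P k.+1 s.
  move=> Pk /agreeP H; apply/agreeP => l; rewrite ltnS leq_eqVlt.
  by case/predU1P => [->//|]; exact: H.
apply: lerD; last apply: lerD.
- rewrite mulr_sumr; apply: ler_sum => s _.
  have [Pk|] := boolP (P k); last by rewrite muln0 mul0r mulr_ge0.
  rewrite muln1 mulrA -natrM MS ler_pM // ?ler_nat; first by nia.
  by case: (boolP (agree P k s)) => // /(agreeS _ Pk) ->.
- rewrite MS ler_pM // ?ler_nat.
    by rewrite leq_mul // leq_pmull // ltnW.
  have [/agreeP H|//] := boolP (agree P k k).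
  rewrite (introT (agreeP _ _ _)) // => l; rewrite ltnS leq_eqVlt.
  by case/predU1P => [->|/H //]; rewrite eqxx.
- have [Pk|] := boolP (P k); last by rewrite muln0 mul0r mulr_ge0.
  have [/agreeP H|_] := boolP (agree P k k); last by rewrite !mulr0 mulr_ge0.
  rewrite (introT (agreeP _ _ _)); last first.
    move=> l; rewrite ltnS leq_eqVlt => /predU1P[->//|lk] _.
    by apply: H; rewrite // neq_ltn lk.
  rewrite !mulr1 muln1 -natrM ler_nat MS.
  have := m_gt1 k; have := M_gt0 m_gt1 k; nia.
Qed.

Lemma leq_majorant (P : pred nat) k :
  (M m k * M m k)%:R * (agree P k k)%:R <= majorant P k.
Proof.
rewrite /majorant big_ord_recr /= lerDr.
by apply: sumr_ge0 => s _; rewrite mulr_ge0.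
Qed.

Section Roots.
Variable z : nat -> R[i].
Hypothesis zm : forall l, z l ^+ m l = 1.
Let P l := z l == 1.

Lemma normc_root l : normc (z l) = 1.
Proof.
have m0 : (m l != 0)%N by rewrite -lt0n ltnW.
apply/eqP; rewrite -(@pexpr_eq1 _ _ (m l)) ?lt0n ?normc_ge0 //.
by rewrite -normcX zm ComplexField.Normc.normc1 eqxx.
Qed.

Lemma normc_geom l a : normc (\sum_(b < a) z l ^+ b) <= a%:R.
Proof.
apply: (le_trans (normc_sum _ _ _)).
under eq_bigr do rewrite normcX normc_root expr1n.
by rewrite sumr_const card_ord.
Qed.

Lemma normc_geom2 l a :
  normc (\sum_(b < a) \sum_(c < b) z l ^+ c) <= (a ^ 2)%:R.
Proof.
apply: (le_trans (normc_sum _ _ _)).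
have : \sum_(b < a) normc (\sum_(c < b) z l ^+ c) <= \sum_(b < a) (a%:R : R).
  by apply: ler_sum => b _; rewrite (le_trans (normc_geom _ _)) // ler_nat ltnW.
by rewrite sumr_const card_ord -mulrnA mulnn.
Qed.

Lemma normc_dirichlet_M k :
  (M m k)%:R * normc (dirichlet z (M m k)) =
  (M m k * M m k)%:R * (agree P k k)%:R.
Proof. by rewrite dirichlet_M // normcM !normc_nat natrM mulrA. Qed.

Lemma normc_fejer_M k :
  normc (fejer z (M m k)) <= (B ^ 2)%:R * majorant P k.
Proof.
elim: k => [|k IH].
  rewrite /fejer /M big_ord0 big_ord1 /dirichlet big_ord0.
  by rewrite ComplexField.Normc.normc0 mulr_ge0 ?majorant_ge0.
rewrite MS fejer_mul // sum_root1 //.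
apply: (le_trans (normcD _ _)).
apply: le_trans (ler_wpM2l _ (le_majorantS P k)); last by [].
rewrite mulrDr; apply: lerD.
  rewrite -normc_dirichlet_M !normcM normc_nat mulrC.
  apply: ler_wpM2r; first by rewrite mulr_ge0 ?normc_ge0.
  by rewrite (le_trans (normc_geom2 _ _)) // ler_nat leq_exp2r.
rewrite -natrM normcM normc_nat mulrC mulrCA.
by apply: ler_wpM2l.
Qed.

(** Peeling off the leading digit [a] of [n = a M_k + b] with [fejerD] leaves,
    besides the Fejer sum of order [b], terms controlled by the majorant of
    level [k]. *)
Lemma normc_fejer_le k n : (n < M m k)%N ->
  normc (fejer z n) <= (3 * B ^ 3)%:R * \sum_(l < k) majorant P l.
Proof.
elim: k n => [|k IH] n nk.
  move: nk; rewrite /M big_ord0 ltnS leqn0 => /eqP ->.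
  by rewrite /fejer !big_ord0 ComplexField.Normc.normc0 mulr0.
have B1 : (0 < B)%N by rewrite (leq_trans _ (m_leB 0)) // ltnW.
have ak : (n %/ M m k < m k)%N by rewrite ltn_divLR ?M_gt0 // -MS.
have bk : (n %% M m k < M m k)%N by rewrite ltn_mod M_gt0.
rewrite (divn_eq n (M m k)); move: (n %/ M m k)%N (n %% M m k)%N ak bk => a b ak bk.
have aB : (a <= B)%N by rewrite (leq_trans (ltnW ak)).
rewrite fejerD ?(ltnW bk) // fejer_mul ?(ltnW ak) // dirichlet_mul ?(ltnW ak) //.
rewrite big_ord_recr /= mulrDr [leRHS]addrC.
apply: (le_trans (normcD _ _)); apply: lerD; last first.
  by rewrite normcM normcX normc_root expr1n mul1r IH.
apply: (le_trans (normcD _ _)).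
have F1 := normc_fejer_M k; have G1 := normc_geom k a.
have G2 := normc_geom2 k a; have L := leq_majorant P k.
have D := normc_dirichlet_M k; have maj0 := majorant_ge0 P k.
have aBR : (a%:R : R) <= B%:R by rewrite ler_nat.
have bMR : (b%:R : R) <= (M m k)%:R by rewrite ler_nat ltnW.
have B1R : (1 : R) <= B%:R by rewrite (ler_nat _ 1).
have T1 : normc ((M m k)%:R * dirichlet z (M m k) *
    (\sum_(i < a) \sum_(c < i) z k ^+ c)) <= majorant P k * B%:R ^+ 2.
  rewrite 2!normcM normc_nat ler_pM ?mulr_ge0 ?normc_ge0 ?D //.
  by rewrite (le_trans G2) // natrX lerXn2r ?nnegrE.
have T2 : normc (fejer z (M m k) * (\sum_(i < a) z k ^+ i)) <=
    (B%:R ^+ 2 * majorant P k) * B%:R.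
  by rewrite normcM ler_pM ?normc_ge0 -?natrX // (le_trans G1).
have T3 : normc (b%:R * (dirichlet z (M m k) * (\sum_(i < a) z k ^+ i))) <=
    majorant P k * B%:R.
  rewrite mulrA 2!normcM normc_nat ler_pM ?mulr_ge0 ?normc_ge0 //.
    by rewrite (le_trans _ L) // -D ler_wpM2r ?normc_ge0.
  by rewrite (le_trans G1).
apply: (le_trans (lerD (normcD _ _) (lexx _))).
apply: (le_trans (lerD (lerD T1 T2) T3)).
rewrite natrM natrX.
have X1 : majorant P k * B%:R <= majorant P k * B%:R ^+ 3.
  by rewrite ler_wpM2l // ler_eXnr.
have X2 : majorant P k * B%:R ^+ 2 <= majorant P k * B%:R ^+ 3.
  by rewrite ler_wpM2l // ler_weXn2l.
by lra.
Qed.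

End Roots.
End Kernel.

(** * Doob's maximal inequality for refining partitions *)

Section MaximalInequality.
Context d (T : measurableType d) (R : realType).
Variables (mu : {measure set T -> \bar R}) (u : T -> \bar R) (lam : R).
Hypotheses (meas_u : measurable_fun setT u) (u_ge0 : forall x, (0 <= u x)%E).
Hypothesis lam_ge0 : 0 <= lam.

Lemma le_measure_integral_bigcup (F : (set T)^nat) :
  (forall n, measurable (F n)) -> trivIset setT F ->
  (forall n, lam%:E * mu (F n) <= \int[mu]_(x in F n) u x)%E ->
  (lam%:E * mu (\bigcup_n F n) <= \int[mu]_(x in \bigcup_n F n) u x)%E.
Proof.
move=> mF tF leF; rewrite ge0_integral_bigcup //; last exact: measurable_funTS.
rewrite measure_bigcup // (@eq_eseriesl _ _ xpredT) => [|n]; last exact: in_setT.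
rewrite -nneseriesZl //.
by apply: lee_nneseries => // n _ _; rewrite mule_ge0 ?lee_fin.
Qed.

(* The [i]-th partition is the one into the level sets of [c i]. *)
Variable c : nat -> T -> nat.
Hypothesis mc : forall i n, measurable (c i @^-1` [set n]).
Hypothesis refine : forall i j x y, (i <= j)%N -> c j x = c j y -> c i x = c i y.

(** The average of [u] over the cell exceeds [lam]; the inequality is multiplied
    out so that null cells are covered. *)
Definition oversized i : set T := [set x |
  (lam%:E * mu (c i @^-1` [set c i x]) <
   \int[mu]_(y in c i @^-1` [set c i x]) u y)%E].

Let oversizedE i : oversized i = \bigcup_(n in [set n |
  (lam%:E * mu (c i @^-1` [set n]) < \int[mu]_(y in c i @^-1` [set n]) u y)%E])
  c i @^-1` [set n].
Proof.
apply/seteqP; split=> [x xb|x [n /= nb xn]]; first by exists (c i x).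
by rewrite /oversized /= xn.
Qed.

Let moversized i : measurable (oversized i).
Proof. by rewrite oversizedE; apply: bigcup_measurable. Qed.

(** The cells of the first level at which a point is oversized are pairwise
    disjoint, by refinement; summing the defining inequality over them gives
    the weak-type bound with constant one. *)
Lemma maximal_inequality :
  measurable (\bigcup_i oversized i) /\
  (lam%:E * mu (\bigcup_i oversized i) <= \int[mu]_x u x)%E.
Proof.
split; first exact: bigcupT_measurable.
have mD i : measurable (seqDU oversized i).
  by apply: measurableD => //; apply: bigsetU_measurable.
rewrite seqDU_bigcup_eq.
apply: (@le_trans _ _ (\int[mu]_(x in \bigcup_i seqDU oversized i) u x)%E); last first.
  apply: ge0_subset_integral => //; exact: bigcupT_measurable.
apply: le_measure_integral_bigcup => // i.
have -> : seqDU oversized i = \bigcup_n (seqDU oversized i `&` c i @^-1` [set n]).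
  rewrite -setI_bigcupr -[LHS]setIT; congr (_ `&` _).
  by apply/esym/seteqP; split=> // x _; exists (c i x).
apply: le_measure_integral_bigcup => [n||n].
- exact: measurableI.
- apply/trivIsetP => a b _ _ /eqP ab; apply/seteqP; split=> // x.
  by case=> -[_ /= xa] [_ /= xb]; apply: ab; rewrite -xa.
have [-> |/set0P[x [xD /= xn]]] := eqVneq (seqDU oversized i `&` c i @^-1` [set n]) set0.
  by rewrite measure0 mule0 integral_set0.
suff -> : seqDU oversized i `&` c i @^-1` [set n] = c i @^-1` [set n].
  by case: xD => /= + _; rewrite /oversized /= xn => /ltW.
apply/seteqP; split=> [y []//|y /= yn]; split=> //; split.
  by case: xD => + _; rewrite /oversized /= xn yn.
move=> yb; case: xD => _; apply.
move: yb; rewrite -!bigcup_mkord => -[j /= ji yj]; exists j => //.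
by move: yj; rewrite /oversized /= (@refine j i y x) ?(ltnW ji) // xn yn.
Qed.

End MaximalInequality.

(** * Cells of the Vilenkin group *)

Section Cells.
Variables (R : realType) (m : nat -> nat) (B : nat).
Hypothesis m_gt1 : forall k, (1 < m k)%N.
Hypothesis m_leB : forall k, (m k <= B)%N.
Implicit Types x t : vilenkin m.

Lemma measurable_coord k (P : pred 'Z_(m k)) :
  measurable [set x : vilenkin m | P (x k)].
Proof.
apply: sub_sigma_algebra; exists k, [set a | P a]%SET.
by apply/seteqP; split=> x /=; rewrite inE.
Qed.

Definition rectangle n (A : forall k : nat, {set 'Z_(m k)}) : set (vilenkin m) :=
  [set x | forall k, (k < n)%N -> x k \in A k].

Lemma measurable_rectangle n A : measurable (rectangle n A).
Proof.
have -> : rectangle n A =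
    \bigcap_k [set x : vilenkin m | (k < n)%N ==> (x k \in A k)].
  apply/seteqP; split=> [x H k _ /=|x H k kn]; first by apply/implyP/H.
  by have /implyP := H k I; apply.
apply: bigcapT_measurable => k; case: ltnP => _ /=.
  exact: (measurable_coord (fun a => a \in A k)).
by rewrite (_ : mkset _ = setT) //; apply/seteqP; split.
Qed.

(** For [k <= s] this is the ball of level [k] around [x]. *)
Definition cell (k s : nat) x : set (vilenkin m) :=
  [set t | agree (fun l => t l == x l) k s].

Lemma cellP k s x t :
  cell k s x t <-> forall l, (l < k)%N -> l != s -> t l = x l.
Proof.
split=> [/agreeP H l lk ls|H]; first exact/eqP/H.
by apply/agreeP => l lk ls; apply/eqP/H.
Qed.

Lemma cell_rectangle k s x : cell k s x =
  rectangle k (fun l => if l == s then [set: 'Z_(m l)]%SET else [set x l]%SET).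
Proof.
apply/seteqP; split=> t.
  by move=> /cellP H l lk; case: eqVneq => [//|ls]; rewrite inE ?H.
by move=> H; apply/cellP => l lk /negPf ls; have := H l lk; rewrite ls inE => /eqP.
Qed.

Lemma measurable_cell k s x : measurable (cell k s x).
Proof. by rewrite cell_rectangle; exact: measurable_rectangle. Qed.

Section Measure.
Variable mu : probability (vilenkin m) R.
Hypothesis hmu : is_product_measure mu.

Lemma mu_ball k x : mu (cell k k x) = ((M m k)%:R^-1)%:E.
Proof.
rewrite cell_rectangle hmu /M natr_prod; congr EFin.
rewrite -prodfV; apply: eq_bigr => l _.
by rewrite /uniform_mass ltn_eqF // cards1 mul1r.
Qed.

Lemma mu_cell_le k s x : (mu (cell k s x) <= (B%:R / (M m k)%:R)%:E)%E.
Proof.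
have m0 l : (m l)%:R != 0 :> R by rewrite pnatr_eq0 -lt0n ltnW.
have m1 l : (1 : R) <= (m l)%:R by rewrite (ler_nat _ 1) ltnW.
have mB l : (m l)%:R <= (B%:R : R) by rewrite ler_nat.
have B1 : (1 : R) <= B%:R by rewrite (le_trans (m1 0%N)).
have um l : uniform_mass R [set: 'Z_(m l)]%SET = 1.
  by rewrite /uniform_mass cardsT card_ord Zp_cast // divff.
rewrite cell_rectangle hmu lee_fin /M natr_prod -prodfV.
have [sk|ks] := ltnP s k; last first.
  apply: le_trans (_ : 1 * \prod_(i < k) (m i)%:R^-1 <= _); last first.
    by rewrite ler_wpM2r // prodr_ge0.
  rewrite mul1r le_eqVlt; apply/orP; left; apply/eqP/eq_bigr => l _.
  by rewrite /uniform_mass ltn_eqF ?(leq_trans _ ks) // cards1 mul1r.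
rewrite (bigD1 (Ordinal sk)) //= [X in _ <= _ * X](bigD1 (Ordinal sk)) //=.
rewrite eqxx um mul1r mulrA.
rewrite (eq_bigr (fun l : 'I_k => (m l)%:R^-1)) => [|l ls]; last first.
  by rewrite -val_eqE /= in ls; rewrite /uniform_mass (negPf ls) cards1 mul1r.
rewrite ler_peMl //.
- by apply: prodr_ge0 => l _.
- by rewrite ler_pdivlMr ?mul1r // (lt_le_trans ltr01).
Qed.

End Measure.

(** Two points have the same code exactly when they share their cell, so that
    the cells are the level sets of an integer-valued function. *)
Definition cell_code (k s : nat) x : nat :=
  pickle [seq (x l : nat) | l <- [seq l <- iota 0 k | l != s]].

Lemma cell_codeP (k s : nat) x t : cell_code k s t = cell_code k s x <-> cell k s x t.
Proof.
rewrite cellP; split=> [/(pcan_inj pickleK)/eq_in_map H l lk ls|H].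
  by apply/val_inj/H; rewrite mem_filter mem_iota ls.
congr pickle; apply/eq_in_map => l; rewrite mem_filter mem_iota /=.
by case/andP=> ls lk; rewrite H.
Qed.

Lemma preimage_cell_code (k s : nat) x :
  cell_code k s @^-1` [set cell_code k s x] = cell k s x.
Proof. by apply/seteqP; split=> t /cell_codeP. Qed.

Lemma measurable_cell_code (k s n : nat) : measurable (cell_code k s @^-1` [set n]).
Proof.
have [->|/set0P[x /= <-]] := eqVneq (cell_code k s @^-1` [set n]) set0 => //.
by rewrite preimage_cell_code; exact: measurable_cell.
Qed.

Lemma subset_cell k s k' s' x : (k <= k')%N -> ((s' < k)%N -> s' = s) ->
  cell k' s' x `<=` cell k s x.
Proof.
move=> kk' ss' t /cellP H; apply/cellP => l lk ls; apply: H.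
  exact: leq_trans kk'.
by apply: contra_neq ls => ls'; rewrite ls' ss' -?ls'.
Qed.

Lemma ge0_integral_sumZ_cell (mu : {measure set (vilenkin m) -> \bar R})
    (u : vilenkin m -> \bar R) (I : Type) (r : seq I) (w : I -> R)
    (k s : I -> nat) x :
  measurable_fun setT u -> (forall t, 0 <= u t)%E -> (forall i, 0 <= w i) ->
  (\int[mu]_t (u t * (\sum_(i <- r)
      w i * (agree (fun l => t l == x l) (k i) (s i))%:R)%:E) =
  \sum_(i <- r) (w i)%:E * \int[mu]_(t in cell (k i) (s i) x) u t)%E.
Proof.
move=> meas_u u0 w0.
have E t : (u t * (\sum_(i <- r)
      w i * (agree (fun l => t l == x l) (k i) (s i))%:R)%:E =
   \sum_(i <- r) (w i)%:E * (u \_ (cell (k i) (s i) x)) t)%E.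
  rewrite -sumEFin ge0_sume_distrr => [|i _]; last by rewrite lee_fin mulr_ge0.
  apply: eq_bigr => i _; rewrite EFinM muleCA patchE; congr (_ * _)%E.
  have [ta|/negP ta] := boolP (agree _ _ _).
    by rewrite mem_set // mule1.
  by rewrite memNset // mule0.
under eq_integral do rewrite E.
have mr i : measurable_fun setT (u \_ (cell (k i) (s i) x)).
  by apply/(measurable_restrictT _ (measurable_cell _ _ _)); exact: measurable_funTS.
have r0 i t : (0 <= (u \_ (cell (k i) (s i) x)) t)%E by rewrite patchE; case: ifP.
rewrite ge0_integral_sum //; last first.
- by move=> i t _; rewrite mule_ge0 ?lee_fin.
- by move=> i; apply: emeasurable_funM.
apply: eq_bigr => i _; rewrite ge0_integralZl ?lee_fin //.
by rewrite -integral_mkcond.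
Qed.

Lemma measurable_majorant k x :
  measurable_fun setT (fun t : vilenkin m => majorant R m (fun l => t l == x l) k).
Proof.
apply: measurable_sum => s; apply: measurable_funM => //.
have -> : (fun t : vilenkin m => (agree (fun l => t l == x l) k s)%:R) =
    \1_(cell k s x) :> (_ -> R).
  by apply/funext => t; rewrite indicE; congr (nat_of_bool _)%:R; apply/idP/idP; rewrite inE.
by apply: measurable_indic; exact: measurable_cell.
Qed.

End Cells.

(** * Weak-type bounds for averages over cells *)

Section CellMaximal.
Variables (R : realType) (m : nat -> nat) (B : nat).
Hypothesis m_gt1 : forall k, (1 < m k)%N.
Hypothesis m_leB : forall k, (m k <= B)%N.
Variable mu : probability (vilenkin m) R.
Hypothesis hmu : is_product_measure mu.
Variable u : vilenkin m -> \bar R.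
Hypotheses (meas_u : measurable_fun setT u) (u_ge0 : forall x, (0 <= u x)%E).

(** When [k] runs through a residue class modulo [j + 1], the coordinate
    [k' - j] omitted at the next level [k' >= k + j + 1] is at least [k], so
    that the cells omitting the coordinate [k - j] refine each other. *)
Lemma cell_maximal_inequality (j : nat) (lam : R) : 0 <= lam ->
  exists E : set (vilenkin m),
    [/\ measurable E, (lam%:E * mu E <= j.+1%:R%:E * \int[mu]_x u x)%E &
     forall x, ~ E x -> forall k, (j <= k)%N ->
       (\int[mu]_(t in cell k (k - j)%N x) u t <= lam%:E * mu (cell k (k - j)%N x))%E].
Proof.
move=> lam0.
pose lev r i : nat := (i * j.+1 + r)%N.
pose c r i (x : vilenkin m) := cell_code (lev r i) (lev r i - j)%N x.
have mc r i n : measurable (c r i @^-1` [set n]).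
  exact: (measurable_cell_code (lev r i) (lev r i - j)%N n).
have refine r i i' x y : (i <= i')%N -> c r i' x = c r i' y -> c r i x = c r i y.
  rewrite leq_eqVlt => /predU1P[->//|ii'] /cell_codeP H; apply/cell_codeP.
  apply: subset_cell H; rewrite /lev; first by rewrite leq_add2r leq_mul2r ltnW.
  by move=> lt; exfalso; nia.
have {refine} := fun r => maximal_inequality mu meas_u u_ge0 lam0 (mc r) (refine r).
pose badr r := \bigcup_i oversized mu u lam (c r) i.
rewrite -/badr => maxE.
have mbad r : measurable (badr r) by case: (maxE r).
exists (\big[setU/set0]_(r < j.+1) badr r); split.
- exact: bigsetU_measurable.
- apply: (@le_trans _ _ (lam%:E * \sum_(r < j.+1) mu (badr r))%E).
    by rewrite lee_wpmul2l ?lee_fin // Boole_inequality.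
  rewrite ge0_sume_distrr // => *.
  apply: (@le_trans _ _ (\sum_(r < j.+1) \int[mu]_x u x)%E).
    by apply: lee_sum => r _; case: (maxE r).
  by rewrite sumr_const card_ord mule_natl.
- move=> x xE k jk; rewrite leNgt; apply/negP => xbad; apply: xE.
  rewrite -(bigcup_mkord j.+1 badr); exists (k %% j.+1)%N => /=; first exact: ltn_pmod.
  exists (k %/ j.+1)%N => //=.
  have ek : lev (k %% j.+1)%N (k %/ j.+1)%N = k by rewrite /lev -divn_eq.
  by rewrite /oversized /= /c ek preimage_cell_code.
Qed.

Let r : R := 2 / 3.

Let sum_weights n : \sum_(0 <= j < n) (j.+1%:R * r ^+ j) <= 9.
Proof.
(* The remainder of the series, of total 9, in closed form. *)
suff -> : \sum_(0 <= j < n) (j.+1%:R * r ^+ j) = 9 - (3 * n%:R + 9) * r ^+ n.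
  by rewrite lerBlDr lerDl mulr_ge0 ?exprn_ge0 // /r; lra.
elim: n => [|n IH]; first by rewrite big_geq // expr0; ring.
by rewrite big_nat_recr //= IH exprS /r -natr1; field.
Qed.

(** Levels [lam (3/2)^j] make the exceptional sets of
    [cell_maximal_inequality] summable over the gap [j = k - s], while the
    weights [M_s / M_k <= 2^-j] of [majorant] absorb the factor [(3/2)^j]. *)
Lemma cells_maximal_inequality (lam : R) : 0 <= lam ->
  exists E : set (vilenkin m),
    [/\ measurable E, (lam%:E * mu E <= 9%:E * \int[mu]_x u x)%E &
     forall x, ~ E x -> forall k s, (s <= k)%N ->
       (\int[mu]_(t in cell k s x) u t <=
          (lam * (3 / 2) ^+ (k - s) * (B%:R / (M m k)%:R))%:E)%E].
Proof.
move=> lam0.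
have lamj j : 0 <= lam * (3 / 2) ^+ j by rewrite mulr_ge0 // exprn_ge0 //; lra.
have [E /all_and3[mE muE xE]] := choice (fun j => cell_maximal_inequality j (lamj j)).
have mUE : measurable (\bigcup_j E j) by exact: bigcupT_measurable.
exists (\bigcup_j E j); split => //; last first.
  move=> x xUE k s sk; have xEj : ~ E (k - s)%N x by move=> ?; apply: xUE; exists (k - s)%N.
  have := xE _ _ xEj k (leq_subr _ _); rewrite subKn // => /le_trans; apply.
  by rewrite [leRHS]EFinM lee_wpmul2l ?lee_fin // mu_cell_le.
have I0 : (0 <= \int[mu]_x u x)%E by exact: integral_ge0.
apply: (@le_trans _ _ (lam%:E * \sum_(0 <= j <oo) mu (E j))%E).
  by rewrite lee_wpmul2l ?lee_fin // generalized_Boole_inequality.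
rewrite -nneseriesZl //.
have w0 j : (0 <= lam%:E * mu (E j))%E by rewrite mule_ge0 ?lee_fin.
apply: lime_le; first exact: is_cvg_nneseries.
near=> n; apply: (@le_trans _ _
    (\sum_(0 <= j < n) (j.+1%:R * r ^+ j)%:E * \int[mu]_x u x)%E).
  apply: lee_sum => j _.
  have rj0 : 0 <= r ^+ j by rewrite exprn_ge0 // /r; lra.
  have := lee_pmul2l; move: (muE j) => /(lee_wpmul2l (_ : (0 <= (r ^+ j)%:E)%E)).
  rewrite lee_fin => /(_ rj0); rewrite !muleA -!EFinM.
  rewrite mulrCA -exprMn (_ : r * (3 / 2) = 1); last by rewrite /r; field.
  by rewrite expr1n mulr1 [r ^+ j * _]mulrC.
rewrite -ge0_sume_distrl; last first.
  by move=> j _; rewrite lee_fin mulr_ge0 // exprn_ge0 // /r; lra.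
rewrite lee_wpmul2r // sumEFin lee_fin; exact: sum_weights.
Unshelve. all: by end_near. Qed.

Let sum_geom n : \sum_(j < n) (3 / 4 : R) ^+ j <= 4.
Proof.
suff -> : \sum_(j < n) (3 / 4 : R) ^+ j = 4 - 4 * (3 / 4) ^+ n.
  by rewrite lerBlDr lerDl mulr_ge0 ?exprn_ge0 //; lra.
elim: n => [|n IH]; first by rewrite big_ord0 expr0; ring.
by rewrite big_ord_recr /= IH exprS; field.
Qed.

Let sum_M n : \sum_(k < n.+1) (M m k)%:R <= 2 * (M m n)%:R :> R.
Proof.
elim: n => [|n IH]; first by rewrite big_ord1 /M big_ord0; lra.
rewrite big_ord_recr /= MS natrM.
have m2 : (2 : R) <= (m n)%:R by rewrite (ler_nat _ 2).
have M0 : (0 : R) <= (M m n)%:R by [].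
by move: IH; rewrite /=; nra.
Qed.

(** Off the exceptional set of [cells_maximal_inequality] the term of [majorant]
    with [k - s = j] integrates to at most [B lam M_k (3/4)^j]; the geometric
    sums over [j], then over [k], give the factors 4 and 2. *)
Lemma majorant_maximal_inequality (lam : R) : 0 <= lam ->
  exists E : set (vilenkin m),
    [/\ measurable E, (lam%:E * mu E <= 9%:E * \int[mu]_x u x)%E &
     forall x, ~ E x -> forall n,
       (\int[mu]_t (u t * (\sum_(k < n.+1)
          majorant R m (fun l => t l == x l) k)%:E) <=
        (8 * B%:R * lam * (M m n)%:R)%:E)%E].
Proof.
move=> lam0; have [E [mE muE xE]] := cells_maximal_inequality lam0.
exists E; split=> // x /xE {}xE n.
have maj0 k t : 0 <= majorant R m (fun l => t l == x l) k by exact: majorant_ge0.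
have bound k : (\int[mu]_t (u t * (majorant R m (fun l => t l == x l) k)%:E) <=
    (4 * B%:R * lam * (M m k)%:R)%:E)%E.
  rewrite /majorant ge0_integral_sumZ_cell //.
  apply: (@le_trans _ _ (\sum_(s < k.+1) (B%:R * lam * (M m k)%:R * (3 / 4) ^+ (k - s))%:E)%E).
    apply: lee_sum => s _; have sk : (s <= k)%N by rewrite -ltnS.
    apply: le_trans (lee_wpmul2l _ (xE k s sk)) _; first by rewrite lee_fin.
    rewrite -EFinM lee_fin natrM.
    have Mk : (0 : R) < (M m k)%:R by rewrite ltr0n M_gt0.
    have Msk : (M m s)%:R * 2 ^+ (k - s) <= (M m k)%:R :> R.
      by have := M_double m_gt1 s (k - s)%N; rewrite subnKC // -natrX -natrM ler_nat mulnC.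
    have -> : (M m s)%:R * (M m k)%:R * (lam * (3 / 2) ^+ (k - s) * (B%:R / (M m k)%:R)) =
        (B%:R * lam * (3 / 4) ^+ (k - s)) * ((M m s)%:R * 2 ^+ (k - s)) :> R.
      rewrite (_ : (3 / 2 : R) = 3 / 4 * 2) ?exprMn; last by field.
      by field; rewrite gt_eqF.
    rewrite [leRHS]mulrAC ler_wpM2l // !mulr_ge0 // exprn_ge0 //; lra.
  rewrite sumEFin lee_fin -mulr_sumr.
  have -> : 4 * B%:R * lam * (M m k)%:R = B%:R * lam * (M m k)%:R * 4 by ring.
  rewrite ler_wpM2l ?mulr_ge0 //.
  rewrite (reindex_inj rev_ord_inj) /=.
  under eq_bigr => s _ do rewrite subSS subKn -1?ltnS //.
  exact: sum_geom.
have distr t : (u t * (\sum_(k < n.+1) majorant R m (fun l => t l == x l) k)%:E =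
    \sum_(k < n.+1) u t * (majorant R m (fun l => t l == x l) k)%:E)%E.
  by rewrite -sumEFin ge0_sume_distrr // => k _; rewrite lee_fin.
under eq_integral do rewrite distr.
rewrite ge0_integral_sum //; last first.
- by move=> k t _; rewrite mule_ge0 ?lee_fin.
- by move=> k; apply: emeasurable_funM => //; apply/measurable_EFinP; exact: measurable_majorant.
apply: (@le_trans _ _ (\sum_(k < n.+1) (4 * B%:R * lam * (M m k)%:R)%:E)%E).
  by apply: lee_sum => k _; exact: bound.
rewrite sumEFin lee_fin -mulr_sumr.
have -> : 8 * B%:R * lam * (M m n)%:R = 4 * B%:R * lam * (2 * (M m n)%:R) by ring.
by rewrite ler_wpM2l ?sum_M // !mulr_ge0.
Qed.

End CellMaximal.

(** * Complex integrals *)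

Section ComplexIntegral.
Variables (R : realType) (m : nat -> nat) (mu : probability (vilenkin m) R).
Implicit Types f g : vilenkin m -> R[i].

Lemma complex_ReD (z w : R[i]) : complex.Re (z + w) = complex.Re z + complex.Re w.
Proof. by case: z w => [? ?] [? ?]. Qed.

Lemma complex_ImD (z w : R[i]) : complex.Im (z + w) = complex.Im z + complex.Im w.
Proof. by case: z w => [? ?] [? ?]. Qed.

Lemma complex_ReM (z w : R[i]) : complex.Re (z * w) =
  complex.Re z * complex.Re w - complex.Im z * complex.Im w.
Proof. by case: z w => [? ?] [? ?]. Qed.

Lemma complex_ImM (z w : R[i]) : complex.Im (z * w) =
  complex.Re z * complex.Im w + complex.Im z * complex.Re w.
Proof. by case: z w => [? ?] [? ?]. Qed.

Definition bounded_measurable g : Prop :=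
  [/\ measurable_fun setT (fun x => complex.Re (g x)),
      measurable_fun setT (fun x => complex.Im (g x)) &
      exists K : R, forall x, normc (g x) <= K].

Lemma bounded_measurable_cst c : bounded_measurable (fun=> c).
Proof. by split=> //; exists (normc c). Qed.

Lemma bounded_measurableD f g : bounded_measurable f -> bounded_measurable g ->
  bounded_measurable (fun x => f x + g x).
Proof.
move=> [mf1 mf2 [K Kf]] [mg1 mg2 [L Lg]]; split.
- under [X in measurable_fun _ X]eq_fun do rewrite complex_ReD.
  exact: measurable_funD.
- under [X in measurable_fun _ X]eq_fun do rewrite complex_ImD.
  exact: measurable_funD.
- by exists (K + L) => x; rewrite (le_trans (normcD _ _)) // lerD.
Qed.

Lemma bounded_measurableM f g : bounded_measurable f -> bounded_measurable g ->
  bounded_measurable (fun x => f x * g x).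
Proof.
move=> [mf1 mf2 [K Kf]] [mg1 mg2 [L Lg]]; split.
- under [X in measurable_fun _ X]eq_fun do rewrite complex_ReM.
  by apply: measurable_funB; apply: measurable_funM.
- under [X in measurable_fun _ X]eq_fun do rewrite complex_ImM.
  by apply: measurable_funD; apply: measurable_funM.
- by exists (K * L) => x; rewrite normcM ler_pM ?normc_ge0.
Qed.

Lemma bounded_measurable_conj f : bounded_measurable f ->
  bounded_measurable (fun x => (f x)^*%C).
Proof.
move=> [mf1 mf2 [K Kf]]; split.
- by rewrite (_ : (fun x => _) = fun x => complex.Re (f x)) //; apply/funext => x; case: (f x).
- rewrite (_ : (fun x => _) = fun x => - complex.Im (f x)); last first.
    by apply/funext => x; case: (f x).
  exact: measurableT_comp.
- by exists K => x; rewrite -lecR normcE normcJ -normcE lecR.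
Qed.

Lemma bounded_measurable_sum (I : Type) (r : seq I) (g : I -> vilenkin m -> R[i]) :
  (forall i, bounded_measurable (g i)) ->
  bounded_measurable (fun x => \sum_(i <- r) g i x).
Proof.
move=> mg; elim: r => [|i r IH].
  under [X in bounded_measurable X]eq_fun do rewrite big_nil.
  exact: bounded_measurable_cst.
under [X in bounded_measurable X]eq_fun do rewrite big_cons.
exact: bounded_measurableD.
Qed.

Lemma bounded_measurable_prod (I : Type) (r : seq I) (g : I -> vilenkin m -> R[i]) :
  (forall i, bounded_measurable (g i)) ->
  bounded_measurable (fun x => \prod_(i <- r) g i x).
Proof.
move=> mg; elim: r => [|i r IH].
  under [X in bounded_measurable X]eq_fun do rewrite big_nil.
  exact: bounded_measurable_cst.
under [X in bounded_measurable X]eq_fun do rewrite big_cons.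
exact: bounded_measurableM.
Qed.

Lemma bounded_measurableX g n : bounded_measurable g ->
  bounded_measurable (fun x => g x ^+ n).
Proof.
move=> mg; elim: n => [|n IH].
  under [X in bounded_measurable X]eq_fun do rewrite expr0.
  exact: bounded_measurable_cst.
under [X in bounded_measurable X]eq_fun do rewrite exprS.
exact: bounded_measurableM.
Qed.

Lemma L1D f g : L1 mu f -> L1 mu g -> L1 mu (fun x => f x + g x).
Proof.
move=> [f1 f2] [g1 g2]; split.
- under [X in _.-integrable _ X]eq_fun do rewrite complex_ReD EFinD.
  exact: integrableD.
- under [X in _.-integrable _ X]eq_fun do rewrite complex_ImD EFinD.
  exact: integrableD.
Qed.

Let integrable_mul (a b : vilenkin m -> R) (K : R) :
  mu.-integrable setT (EFin \o a) -> measurable_fun setT b ->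
  (forall x, `|b x| <= K) -> mu.-integrable setT (fun x => (a x * b x)%:E).
Proof.
move=> ia mb Kb; apply: (integrableMl measurableT ia mb).
exists K; split; first exact: num_real.
by move=> L KL x _ /=; rewrite (le_trans (Kb x)) // ltW.
Qed.

Lemma L1M f g : L1 mu f -> bounded_measurable g -> L1 mu (fun x => f x * g x).
Proof.
move=> [f1 f2] [g1 g2 [K Kg]].
have K1 x : `|complex.Re (g x)| <= K by rewrite (le_trans (Re_le_normc _)).
have K2 x : `|complex.Im (g x)| <= K by rewrite (le_trans (Im_le_normc _)).
split.
- under [X in _.-integrable _ X]eq_fun do rewrite complex_ReM EFinB.
  by apply: integrableB => //; apply: integrable_mul; eauto.
- under [X in _.-integrable _ X]eq_fun do rewrite complex_ImM EFinD.
  by apply: integrableD => //; apply: integrable_mul; eauto.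
Qed.

Lemma L1Z c f : L1 mu f -> L1 mu (fun x => f x * c).
Proof. by move=> f1; apply: L1M => //; exact: bounded_measurable_cst. Qed.

Lemma bounded_measurable_L1 g : bounded_measurable g -> L1 mu g.
Proof.
move=> mg; under [X in L1 _ X]eq_fun do rewrite -[g _]mul1r.
apply: L1M => //; split; exact: finite_measure_integrable_cst.
Qed.

Lemma cintegralD f g : L1 mu f -> L1 mu g ->
  cintegral mu (fun x => f x + g x) = cintegral mu f + cintegral mu g.
Proof.
move=> [f1 f2] [g1 g2]; apply/eqP; rewrite eq_complex /=; apply/andP; split; apply/eqP.
- under eq_Rintegral do rewrite complex_ReD.
  by rewrite RintegralD.
- under eq_Rintegral do rewrite complex_ImD.
  by rewrite RintegralD.
Qed.

Lemma cintegralZ c f : L1 mu f ->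
  cintegral mu (fun x => f x * c) = cintegral mu f * c.
Proof.
case: c => a b [f1 f2]; apply/eqP; rewrite eq_complex /=; apply/andP; split; apply/eqP.
- under eq_Rintegral do rewrite complex_ReM /=.
  rewrite RintegralB ?RintegralZr //.
  + under [X in _.-integrable _ X]eq_fun do rewrite /= EFinM.
    exact: integrableZr.
  + under [X in _.-integrable _ X]eq_fun do rewrite /= EFinM.
    exact: integrableZr.
- under eq_Rintegral do rewrite complex_ImM /=.
  rewrite RintegralD ?RintegralZr //.
  + under [X in _.-integrable _ X]eq_fun do rewrite /= EFinM.
    exact: integrableZr.
  + under [X in _.-integrable _ X]eq_fun do rewrite /= EFinM.
    exact: integrableZr.
Qed.

Lemma cintegral0 : cintegral mu (fun=> 0) = 0.
Proof. by rewrite /cintegral /Rintegral !integral0. Qed.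

Lemma sum_cintegralM f (I : Type) (r : seq I) (g : I -> vilenkin m -> R[i])
    (a : I -> R[i]) : L1 mu f -> (forall i, bounded_measurable (g i)) ->
  \sum_(i <- r) cintegral mu (fun x => f x * g i x) * a i =
  cintegral mu (fun x => f x * \sum_(i <- r) g i x * a i).
Proof.
move=> f1 mg; elim: r => [|i r IH].
  rewrite big_nil -[LHS]cintegral0; congr cintegral; apply/funext => x.
  by rewrite big_nil mulr0.
rewrite big_cons IH -cintegralZ; last exact: L1M.
have mga j : bounded_measurable (fun x => g j x * a j).
  by apply: bounded_measurableM => //; exact: bounded_measurable_cst.
rewrite -cintegralD.
- by congr cintegral; apply/funext => x; rewrite big_cons mulrDr mulrA.
- by apply: L1Z; exact: L1M.
- by apply: L1M => //; exact: bounded_measurable_sum.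
Qed.

(** Bounding the real and the imaginary part separately costs the harmless
    factor 2. *)
Lemma normc_cintegral_le f (u : vilenkin m -> \bar R) : L1 mu f ->
  measurable_fun setT u -> (forall x, (normc (f x))%:E <= u x)%E ->
  ((normc (cintegral mu f))%:E <= 2%:E * \int[mu]_x u x)%E.
Proof.
move=> [f1 f2] mu' fu.
apply: (@le_trans _ _ (`|\int[mu]_x complex.Re (f x)| + `|\int[mu]_x complex.Im (f x)|)%:E).
  by rewrite lee_fin (le_trans (normc_le_ReIm _)).
rewrite (_ : 2%:E = 1 + 1)%E // ge0_muleDl // !mul1e EFinD.
have u0 x : (0 <= u x)%E by rewrite (le_trans _ (fu x)) // lee_fin normc_ge0.
have part (a : vilenkin m -> R) : mu.-integrable setT (fun x => (a x)%:E) ->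
    (forall x, `|a x| <= normc (f x)) ->
    (`|\int[mu]_x a x|%:E <= \int[mu]_x u x)%E.
  move=> ia la; rewrite EFin_normr_Rintegral //.
  have ma : measurable_fun setT (EFin \o a) by case/integrableP: ia.
  apply: (le_trans (le_abse_integral mu measurableT ma)).
  apply: ge0_le_integral => //; first exact: measurableT_comp.
  by move=> x _; rewrite (le_trans _ (fu x)) // lee_fin.
by apply: leeD; apply: part => // x; [exact: Re_le_normc|exact: Im_le_normc].
Qed.

End ComplexIntegral.

(** * Vilenkin functions and their kernels *)

Section Characters.
Variables (R : realType) (m : nat -> nat).
Hypothesis m_gt1 : forall k, (1 < m k)%N.
Implicit Types x t : vilenkin m.

Lemma de_moivre (a : R) n :
  ((cos a +i* sin a)%C : R[i]) ^+ n = (cos (n%:R * a) +i* sin (n%:R * a))%C.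
Proof.
elim: n => [|n IH]; first by rewrite expr0 mul0r cos0 sin0.
rewrite exprS IH -natr1 mulrDl mul1r addrC cosD sinD.
by apply/eqP; rewrite eq_complex /= [cos a * sin _ + _]addrC; apply/andP; split; apply/eqP; ring.
Qed.

Lemma cos_eq1 (a : R) : cos a = 1 -> `|a| < 2 * pi -> a = 0.
Proof.
move=> ca a2.
have s0 : sin (a / 2) = 0.
  apply/eqP; rewrite -sqrf_eq0; apply/eqP.
  have := cos2Dsin2 (a / 2); move: ca; rewrite {1}[a]splitr cosD; nra.
have spos (b : R) : 0 < b -> b < 2 * pi -> sin (b / 2) != 0.
  by move=> b0 b2; rewrite gt_eqF // sin_gt0_pi //; apply/andP; split; lra.
move: a2; rewrite ltr_norml => /andP[a1 a2].
have [a0|a0|//] := ltrgtP a 0.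
  have /eqP[] : sin (- a / 2) != 0 by apply: spos; lra.
  by rewrite mulNr sinN s0 oppr0.
by move/eqP: (spos a a0 a2); rewrite s0.
Qed.

Lemma rademacher_root k x : rademacher R k x ^+ m k = 1.
Proof.
rewrite /rademacher de_moivre.
have -> : (m k)%:R * (2 * pi * (x k : nat)%:R / (m k)%:R) =
    (x k : nat)%:R * (2 * pi) :> R.
  by field; rewrite pnatr_eq0 -lt0n ltnW.
rewrite -de_moivre (_ : 2 * pi = pi + pi :> R); last by ring.
rewrite cosD sinD cospi sinpi (_ : (_ +i* _)%C = 1) ?expr1n //.
by apply/eqP; rewrite eq_complex /=; apply/andP; split; apply/eqP; ring.
Qed.

Lemma normc_rademacher k x : normc (rademacher R k x) = 1.
Proof. by rewrite /rademacher /= cos2Dsin2 sqrtr1. Qed.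

(** The value at [x - t] of the [l]-th Rademacher function. *)
Definition phase x t l : R[i] := rademacher R l x * (rademacher R l t)^*%C.

Lemma phase_root x t l : phase x t l ^+ m l = 1.
Proof. by rewrite exprMn -rmorphXn !rademacher_root mul1r rmorph1. Qed.

Lemma phase_eq1 x t l : (phase x t l == 1) = (t l == x l).
Proof.
have m0 : 0 < (m l)%:R :> R by rewrite ltr0n ltnW.
apply/eqP/eqP => [|tx]; last first.
  rewrite /phase (_ : rademacher R l t = rademacher R l x); last by rewrite /rademacher tx.
  by rewrite -sqr_normc -normcE normc_rademacher expr1n.
move=> /(congr1 (@complex.Re R)); rewrite complex_ReM /= mulrN opprK -cosB.
set d := _ - _ => cd.
have dE : d * (m l)%:R = 2 * pi * ((x l : nat)%:R - (t l : nat)%:R).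
  by rewrite /d; field; rewrite gt_eqF.
have lt_m (y : vilenkin m) : (y l : nat)%:R < (m l)%:R :> R.
  by rewrite ltr_nat -[ltnRHS](Zp_cast (m_gt1 l)).
have ge0 (y : vilenkin m) : 0 <= (y l : nat)%:R :> R by [].
have pi0 : 0 < pi :> R by exact: pi_gt0.
have d0 : d = 0.
  apply: (cos_eq1 cd); rewrite -(ltr_pM2r m0) -{1}(gtr0_norm m0) -normrM dE.
  rewrite normrM gtr0_norm ?mulr_gt0 //.
  rewrite ltr_pM2l ?mulr_gt0 // ltr_norml.
  have := lt_m x; have := lt_m t; have := ge0 x; have := ge0 t; lra.
apply/val_inj/eqP; rewrite -(eqr_nat R) eq_sym -subr_eq0.
move: dE; rewrite d0 mul0r => /esym/eqP; rewrite mulf_eq0 (gt_eqF _) //.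
by rewrite mulr_gt0.
Qed.

Lemma psi_phase x t k :
  psi R k x * (psi R k t)^*%C = digit_monomial m (phase x t) k.
Proof.
rewrite /psi rmorph_prod /digit_monomial -big_split /=.
by apply: eq_bigr => l _; rewrite exprMn rmorphXn.
Qed.

Lemma measurable_fun_coord k (g : 'Z_(m k) -> R) :
  measurable_fun setT (fun x : vilenkin m => g (x k)).
Proof.
move=> _ Y _; rewrite setTI.
have -> : (fun x : vilenkin m => g (x k)) @^-1` Y =
    [set x | (fun a => `[< Y (g a) >]) (x k)].
  by apply/seteqP; split=> x /=; rewrite asboolE.
exact: (measurable_coord (fun a => `[< Y (g a) >])).
Qed.

Lemma bounded_measurable_psi k : bounded_measurable (psi R k : vilenkin m -> _).
Proof.
apply: bounded_measurable_prod => l; apply: bounded_measurableX; split.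
- exact: (measurable_fun_coord (fun a => cos (2 * pi * (a : nat)%:R / (m l)%:R))).
- exact: (measurable_fun_coord (fun a => sin (2 * pi * (a : nat)%:R / (m l)%:R))).
- by exists 1 => x; rewrite normc_rademacher.
Qed.

End Characters.

Section FourierSums.
Variables (R : realType) (m : nat -> nat) (B : nat).
Hypothesis m_gt1 : forall k, (1 < m k)%N.
Hypothesis m_leB : forall k, (m k <= B)%N.
Variable mu : probability (vilenkin m) R.
Hypothesis hmu : is_product_measure mu.
Implicit Types (f g : vilenkin m -> R[i]) (x t : vilenkin m).

Lemma bounded_measurable_dirichlet x n :
  bounded_measurable (fun t => dirichlet m (phase R x t) n).
Proof.
apply: bounded_measurable_sum => k.
under [X in bounded_measurable X]eq_fun do rewrite -psi_phase.
apply: bounded_measurableM; first exact: bounded_measurable_cst.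
exact/bounded_measurable_conj/bounded_measurable_psi.
Qed.

Lemma bounded_measurable_fejer x n :
  bounded_measurable (fun t => fejer m (phase R x t) n).
Proof. by apply: bounded_measurable_sum => k; exact: bounded_measurable_dirichlet. Qed.

Lemma partial_sumE f n x : L1 mu f ->
  partial_sum mu f n x = cintegral mu (fun t => f t * dirichlet m (phase R x t) n).
Proof.
move=> f1; rewrite /partial_sum /fourier_coef sum_cintegralM //; last first.
  by move=> k; exact/bounded_measurable_conj/bounded_measurable_psi.
congr cintegral; apply/funext => t; congr (_ * _); apply: eq_bigr => k _.
by rewrite -psi_phase mulrC.
Qed.

Lemma sum_partial_sum f n x : L1 mu f ->
  \sum_(k < n) partial_sum mu f k x =
  cintegral mu (fun t => f t * fejer m (phase R x t) n).
Proof.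
move=> f1; under eq_bigr => k _ do rewrite partial_sumE // -[cintegral _ _]mulr1.
rewrite sum_cintegralM // => [|k]; last exact: bounded_measurable_dirichlet.
congr cintegral; apply/funext => t; congr (_ * _); apply: eq_bigr => k _.
by rewrite mulr1.
Qed.

Definition norm1 f x : R := `|complex.Re (f x)| + `|complex.Im (f x)|.

Lemma measurable_norm1 f : L1 mu f -> measurable_fun setT (EFin \o norm1 f).
Proof.
move=> [/integrableP[/measurable_EFinP m1 _] /integrableP[/measurable_EFinP m2 _]].
by apply/measurable_EFinP; apply: measurable_funD; exact: measurableT_comp.
Qed.

(** The Fejer kernel of order [n < M_(k+1)] is bounded by the majorants of level
    at most [k], whose integrals are controlled by [M_k <= n]. *)
Lemma fejer_maximal_inequality f (lam : R) : L1 mu f -> 0 <= lam ->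
  exists E : set (vilenkin m),
    [/\ measurable E, (lam%:E * mu E <= 9%:E * \int[mu]_x (norm1 f x)%:E)%E &
     forall x, ~ E x -> forall n,
       normc (\sum_(k < n) partial_sum mu f k x) <= (48 * B ^ 4)%:R * lam * n%:R].
Proof.
move=> f1 lam0.
have norm0 x : (0 <= (EFin \o norm1 f) x)%E by rewrite /= lee_fin addr_ge0.
have [E [mE muE xE]] := majorant_maximal_inequality m_gt1 m_leB hmu
  (measurable_norm1 f1) norm0 lam0.
exists E; split=> // x /xE {}xE n; rewrite sum_partial_sum //.
case: (posnP n) => [->|n0].
  under [X in cintegral _ X]eq_fun do rewrite /fejer big_ord0 mulr0.
  by rewrite cintegral0 ComplexField.Normc.normc0 mulr0.
have [k kn nk] : exists2 k, (M m k <= n)%N & (n < M m k.+1)%N.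
  have ex : exists k, (n < M m k)%N by exists n; exact: ltn_M.
  case: (ex_minnP ex) => -[|k] nk kmin.
    by move: nk; rewrite /M big_ord0 ltnNge n0.
  by exists k; rewrite // leqNgt; apply/negP => /kmin; rewrite ltnn.
have maj0 t : 0 <= \sum_(l < k.+1) majorant R m (fun i => t i == x i) l.
  by apply: sumr_ge0 => l _; exact: majorant_ge0.
have mmaj : measurable_fun setT (fun t : vilenkin m =>
    \sum_(l < k.+1) majorant R m (fun i => t i == x i) l).
  by apply: measurable_sum => l; exact: measurable_majorant.
pose u t : \bar R := ((3 * B ^ 3)%:R%:E * ((EFin \o norm1 f) t *
  (\sum_(l < k.+1) majorant R m (fun i => t i == x i) l)%:E))%E.
have mu0 : measurable_fun setT (fun t => (EFin \o norm1 f) t *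
  (\sum_(l < k.+1) majorant R m (fun i => t i == x i) l)%:E)%E.
  by apply: emeasurable_funM; [exact: measurable_norm1|exact/measurable_EFinP].
have le_u t : ((normc (f t * fejer m (phase R x t) n))%:E <= u t)%E.
  rewrite /u /= -!EFinM lee_fin normcM mulrCA ler_pM ?normc_ge0 //.
    exact: normc_le_ReIm.
  rewrite (le_trans (normc_fejer_le m_gt1 m_leB (phase_root R m_gt1 x t) nk)) //.
  rewrite ler_wpM2l // ler_sum // => l _; rewrite /majorant ler_sum // => s _.
  by rewrite (@agree_eq _ (fun i => t i == x i)) // => i; rewrite phase_eq1.
have L1K : L1 mu (fun t => f t * fejer m (phase R x t) n).
  by apply: L1M => //; exact: bounded_measurable_fejer.
rewrite -lee_fin (le_trans (normc_cintegral_le L1K _ le_u)) //.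
  by apply: emeasurable_funM.
rewrite ge0_integralZl ?lee_fin // => [|t _]; last first.
  by rewrite mule_ge0 // lee_fin.
apply: (@le_trans _ _ (2%:E * ((3 * B ^ 3)%:R%:E *
    (8 * B%:R * lam * (M m k)%:R)%:E))%E).
  by rewrite !lee_wpmul2l ?lee_fin.
rewrite -!EFinM lee_fin.
have -> : 2 * ((3 * B ^ 3)%:R * (8 * B%:R * lam * (M m k)%:R)) =
    (48 * B ^ 4)%:R * lam * (M m k)%:R :> R by rewrite (natrM _ 3) (natrM _ 48) !natrX; ring.
by rewrite ler_wpM2l ?mulr_ge0 // ler_nat.
Qed.

End FourierSums.

(** * T means *)

Section TMeans.
Variables (R : realType) (m : nat -> nat) (B : nat).
Hypothesis m_gt1 : forall k, (1 < m k)%N.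
Hypothesis m_leB : forall k, (m k <= B)%N.
Variable mu : probability (vilenkin m) R.
Hypothesis hmu : is_product_measure mu.
Variable q : nat -> R.
Hypothesis q0_gt0 : 0 < q 0%N.
Hypothesis q_ge0 : forall k, 0 <= q k.
Hypothesis q_noninc : nonincreasing_seq q.
Hypothesis Q_infty : Q q n @[n --> \oo] --> +oo.
Implicit Types (f g : vilenkin m -> R[i]) (x t : vilenkin m).

Lemma QS n : Q q n.+1 = Q q n + q n.
Proof. by rewrite /Q big_ord_recr. Qed.

Lemma Q_ge0 n : 0 <= Q q n.
Proof. exact: sumr_ge0. Qed.

Lemma Q_gt0 n : (0 < n)%N -> 0 < Q q n.
Proof.
case: n => // n _; rewrite /Q big_ord_recl ltr_wpDr //.
exact: sumr_ge0.
Qed.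

(** Abel summation: the weights [q_k - q_(k+1)] and [q_n] of the partial sums
    are non-negative, and the same summation for [a = 1] gives [Q_n]. *)
Lemma normc_weighted_sum_le (a : nat -> R[i]) (c : R) :
  (forall n, normc (\sum_(k < n) a k) <= c * n%:R) ->
  forall n, normc (\sum_(k < n) (q k)%:C%C * a k) <= c * Q q n.
Proof.
move=> ac n; set A := fun n => \sum_(k < n) a k.
have H : normc (\sum_(k < n) (q k)%:C%C * a k - (q n)%:C%C * A n) <=
    c * (Q q n - n%:R * q n).
  elim: n => [|n IH].
    by rewrite /A /Q !big_ord0 mulr0 subrr ComplexField.Normc.normc0 mul0r subrr mulr0.
  have dq : 0 <= q n - q n.+1 by rewrite subr_ge0; exact: q_noninc.
  have -> : \sum_(k < n.+1) (q k)%:C%C * a k - (q n.+1)%:C%C * A n.+1 =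
      (\sum_(k < n) (q k)%:C%C * a k - (q n)%:C%C * A n) +
      (q n - q n.+1)%:C%C * A n.+1.
    by rewrite rmorphB /= /A !big_ord_recr /=; ring.
  rewrite (le_trans (normcD _ _)) // normcM normc_real ger0_norm //.
  apply: le_trans (lerD IH (ler_wpM2l dq (ac n.+1))) _.
  by rewrite QS -natr1 le_eqVlt; apply/orP; left; apply/eqP; ring.
have H2 : normc ((q n)%:C%C * A n) <= q n * (c * n%:R).
  by rewrite normcM normc_real ger0_norm // ler_wpM2l // ac.
rewrite -[X in normc X](subrK ((q n)%:C%C * A n)).
rewrite (le_trans (normcD _ _)) //; apply: le_trans (lerD H H2) _.
by rewrite le_eqVlt; apply/orP; left; apply/eqP; ring.
Qed.

Lemma normc_T_mean_le f x (c : R) : 0 <= c ->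
  (forall n, normc (\sum_(k < n) partial_sum mu f k x) <= c * n%:R) ->
  forall n, normc (T_mean mu q f n x) <= c.
Proof.
move=> c0 fc n; rewrite /T_mean normcM normc_real.
case: (posnP n) => [->|/Q_gt0 Q0].
  by rewrite [in X in _ * normc X]big_ord0 ComplexField.Normc.normc0 mulr0.
rewrite ger0_norm ?invr_ge0 ?Q_ge0 // mulrC ler_pdivrMr //.
exact: (normc_weighted_sum_le (a := fun k => partial_sum mu f k x)).
Qed.

Definition T_mean_cvg f x : Prop := forall e : R, 0 < e ->
  exists N, forall n, (N <= n)%N -> normc (T_mean mu q f n x - f x) <= e.

Lemma fourier_coefD f g k : L1 mu f -> L1 mu g ->
  fourier_coef mu (fun x => f x + g x) k = fourier_coef mu f k + fourier_coef mu g k.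
Proof.
move=> f1 g1; have Bp := bounded_measurable_conj (bounded_measurable_psi R m k).
rewrite /fourier_coef -cintegralD; try exact: L1M.
by congr cintegral; apply/funext => x; rewrite mulrDl.
Qed.

Lemma fourier_coefZ f c k : L1 mu f ->
  fourier_coef mu (fun x => f x * c) k = fourier_coef mu f k * c.
Proof.
move=> f1; have Bp := bounded_measurable_conj (bounded_measurable_psi R m k).
rewrite /fourier_coef -cintegralZ; last exact: L1M.
by congr cintegral; apply/funext => x; rewrite mulrAC.
Qed.

Lemma T_meanD f g n x : L1 mu f -> L1 mu g ->
  T_mean mu q (fun x => f x + g x) n x = T_mean mu q f n x + T_mean mu q g n x.
Proof.
move=> f1 g1; rewrite /T_mean -mulrDr -big_split /=; congr (_ * _).
apply: eq_bigr => k _; rewrite -mulrDr /partial_sum -big_split /=; congr (_ * _).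
by apply: eq_bigr => l _; rewrite fourier_coefD // mulrDl.
Qed.

Lemma T_meanZ f c n x : L1 mu f ->
  T_mean mu q (fun x => f x * c) n x = T_mean mu q f n x * c.
Proof.
move=> f1; rewrite /T_mean -mulrA mulr_suml; congr (_ * _).
apply: eq_bigr => k _; rewrite -mulrA /partial_sum mulr_suml; congr (_ * _).
by apply: eq_bigr => l _; rewrite fourier_coefZ // mulrAC.
Qed.

Lemma T_mean_cvgD f g x : L1 mu f -> L1 mu g ->
  T_mean_cvg f x -> T_mean_cvg g x -> T_mean_cvg (fun x => f x + g x) x.
Proof.
move=> f1 g1 cf cg e e0; have e2 : 0 < e / 2 by rewrite divr_gt0.
have [N1 H1] := cf _ e2; have [N2 H2] := cg _ e2.
exists (maxn N1 N2) => n; rewrite geq_max => /andP[n1 n2].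
rewrite T_meanD // opprD addrACA (le_trans (normcD _ _)) // [e]splitr.
by rewrite lerD ?H1 ?H2.
Qed.

Lemma T_mean_cvgZ f c x : L1 mu f ->
  T_mean_cvg f x -> T_mean_cvg (fun x => f x * c) x.
Proof.
move=> f1 cf e e0.
have c1 : 0 < normc c + 1 by rewrite ltr_wpDl ?normc_ge0.
have [N H] := cf _ (divr_gt0 e0 c1); exists N => n /H {}H.
rewrite T_meanZ // -mulrBl normcM.
apply: (@le_trans _ _ (e / (normc c + 1) * (normc c + 1))); last by rewrite divfK ?gt_eqF.
by rewrite ler_pM ?normc_ge0 // lerDl.
Qed.

(** Only the finitely many terms [k < J] contribute to [Q_n (T_n f x - f x)],
    while [Q_n] tends to infinity. *)
Lemma T_mean_cvg_eventually f x J :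
  (forall j, (J <= j)%N -> partial_sum mu f j x = f x) -> T_mean_cvg f x.
Proof.
move=> fJ e e0; pose d k := normc (partial_sum mu f k x - f x).
pose C := \sum_(k < J) q k * d k.
have /cvgryPge/(_ (C / e))[N _ HN] := Q_infty.
exists (maxn N (maxn 1 J)) => n; rewrite !geq_max => /and3P[Nn n1 Jn].
have Qn := Q_gt0 n1.
have -> : T_mean mu q f n x - f x = ((Q q n)^-1)%:C%C *
    \sum_(k < n) (q k)%:C%C * (partial_sum mu f k x - f x).
  under eq_bigr do rewrite mulrBr.
  rewrite sumrB mulrBr; congr (_ - _).
  rewrite -mulr_suml mulrA -rmorph_sum /= -rmorphM /=.
  by rewrite [\sum_(i < n) _](_ : _ = Q q n) // mulVf ?gt_eqF // mul1r.
rewrite normcM normc_real ger0_norm ?invr_ge0 ?Q_ge0 // mulrC ler_pdivrMr //.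
apply: (@le_trans _ _ C); last by rewrite mulrC -ler_pdivrMr //; exact: HN.
apply: (le_trans (normc_sum _ _ _)).
rewrite -(subnKC Jn) big_split_ord /= [X in _ + X]big1 => [|k _]; last first.
  by rewrite fJ ?leq_addr // subrr mulr0 ComplexField.Normc.normc0.
rewrite addr0; apply: ler_sum => k _.
by rewrite normcM normc_real ger0_norm.
Qed.

Definition cindic (A : set (vilenkin m)) x : R[i] := (\1_A x)%:C%C.

Lemma bounded_measurable_cindic A : measurable A -> bounded_measurable (cindic A).
Proof.
move=> mA; split; [exact: measurable_indic|exact: measurable_cst|].
by exists 1 => x; rewrite /cindic normc_real indicE ger0_norm // (ler_nat _ _ 1) leq_b1.
Qed.

Lemma cintegral_cindic A : measurable A -> cintegral mu (cindic A) = (fine (mu A))%:C%C.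
Proof.
move=> mA; rewrite /cintegral /cindic /=; congr (_ +i* _)%C.
  by rewrite /Rintegral integral_indic // setIT.
by rewrite /Rintegral integral0.
Qed.

(** Conjugating [S_n f] and integrating term by term against [f] produces the
    coefficients of [f] a second time. *)
Lemma parseval f n : L1 mu f ->
  cintegral mu (fun t => f t * (partial_sum mu f n t)^*%C) =
  \sum_(k < n) fourier_coef mu f k * (fourier_coef mu f k)^*%C.
Proof.
move=> f1; rewrite /fourier_coef sum_cintegralM //; last first.
  by move=> k; exact/bounded_measurable_conj/bounded_measurable_psi.
congr cintegral; apply/funext => t; congr (_ * _).
rewrite /partial_sum rmorph_sum; apply: eq_bigr => k _.
by rewrite rmorphM mulrC.
Qed.

Section Rectangle.
Variables (N : nat) (A : forall k : nat, {set 'Z_(m k)}).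
Let g := cindic (rectangle N A).

Let g1 : L1 mu g.
Proof.
apply: bounded_measurable_L1; apply: bounded_measurable_cindic.
exact: measurable_rectangle.
Qed.

(** The Dirichlet kernel of order [M_k] is [M_k] times the indicator of the
    ball of level [k], on which [g] is constant when [N <= k]. *)
Lemma partial_sum_M_rectangle k x : (N <= k)%N -> partial_sum mu g (M m k) x = g x.
Proof.
move=> Nk; rewrite partial_sumE //.
have -> : (fun t => g t * dirichlet m (phase R x t) (M m k)) =
    (fun t => cindic (cell k k x) t * ((M m k)%:R * g x)).
  apply/funext => t; rewrite dirichlet_M //; last by move=> l; exact: phase_root.
  rewrite (@agree_eq _ (fun l => t l == x l)) => [|l]; last exact: phase_eq1.
  have [tx|/negP tx] := boolP (agree _ _ _); last first.
    by rewrite mulr0 mulr0 /cindic indicE memNset // mul0r.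
  rewrite mulr1 /cindic indicE mem_set // mul1r mulrC; congr (_ * _).
  rewrite /g /cindic !indicE; congr (_%:R)%:C%C; congr nat_of_bool.
  have /cellP tx' : cell k k x t by [].
  have e l : (l < N)%N -> t l = x l.
    by move=> lN; apply: tx'; [exact: leq_trans Nk|rewrite ltn_eqF // (leq_trans lN)].
  by apply/idP/idP; rewrite !inE => H l lN; move: (H l lN); rewrite e.
rewrite cintegralZ; last first.
  apply: bounded_measurable_L1; apply: bounded_measurable_cindic.
  exact: measurable_cell.
rewrite cintegral_cindic; last exact: measurable_cell.
rewrite mu_ball // mulrA -[RHS]mul1r; congr (_ * _).
rewrite /= fmorphV /= rmorph_nat mulVf // pnatr_eq0 -lt0n; exact: M_gt0.
Qed.

(** The square sums of the coefficients over [k < M_K] do not depend on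
    [K >= N], because the partial sums of order [M_K] do not; so the
    coefficients between [M_N] and [M_K] vanish. *)
Lemma fourier_coef_rectangle k : (M m N <= k)%N -> fourier_coef mu g k = 0.
Proof.
move=> Nk; pose K := maxn N k.
have kK : (k < M m K)%N by rewrite (leq_trans (ltn_M m_gt1 k)) // leq_M // leq_maxr.
have NK : (M m N <= M m K)%N by rewrite leq_M // leq_maxl.
have sq n : (N <= n)%N ->
    \sum_(0 <= i < M m n) fourier_coef mu g i * (fourier_coef mu g i)^*%C =
    cintegral mu (fun t => g t * (g t)^*%C).
  move=> Nn; rewrite big_mkord -parseval //; congr cintegral; apply/funext => t.
  by rewrite partial_sum_M_rectangle.
have := sq K (leq_maxl _ _); rewrite -(sq N (leqnn N)) (big_cat_nat (leq0n _) NK) //=.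
rewrite -[RHS]addr0 => /addrI/eqP; rewrite psumr_eq0 => [|i _]; last exact: mulcJ_ge0.
move=> /allP /(_ k); rewrite mem_index_iota Nk kK => /(_ isT) /=.
by rewrite -sqr_normc expf_eq0 normr_eq0 => /eqP.
Qed.

Lemma T_mean_cvg_rectangle x : T_mean_cvg g x.
Proof.
apply: (@T_mean_cvg_eventually _ _ (M m N)) => j Nj.
rewrite -[RHS](@partial_sum_M_rectangle N) // /partial_sum -(subnKC Nj) big_split_ord /=.
rewrite [X in _ + X]big1 ?addr0 // => k _.
by rewrite fourier_coef_rectangle ?leq_addr // mul0r.
Qed.

End Rectangle.

End TMeans.

(** * Almost everywhere convergence *)

Lemma negligible_small d (T : measurableType d) (R : realType)
    (mu : {measure set T -> \bar R}) (A : set T) :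
  (forall e : R, 0 < e -> exists E, [/\ measurable E, A `<=` E & (mu E <= e%:E)%E]) ->
  mu.-negligible A.
Proof.
move=> small.
have /choice[E EP] n : exists E,
    [/\ measurable E, A `<=` E & (mu E <= (n.+1%:R^-1)%:E)%E].
  by apply: small; rewrite invr_gt0.
have mE : measurable (\bigcap_n E n) by apply: bigcapT_measurable => n; case: (EP n).
exists (\bigcap_n E n); split => //; last by move=> x Ax n _; case: (EP n) => _ /(_ x Ax).
apply/eqP; rewrite -measure_le0; apply/lee_addgt0Pr => e e0; rewrite add0e.
have [n ne] := ltr_add_invr e0; rewrite add0r in ne.
have [mEn _ muE] := EP n.
apply: (@le_trans _ _ (mu (E n))).
  by apply: le_measure; rewrite ?inE //; exact: bigcap_inf.
by rewrite (le_trans muE) // lee_fin ltW.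
Qed.

Import HBSimple.

Section AlmostEverywhere.
Variables (R : realType) (m : nat -> nat) (B : nat).
Hypothesis m_gt1 : forall k, (1 < m k)%N.
Hypothesis m_leB : forall k, (m k <= B)%N.
Variable mu : probability (vilenkin m) R.
Hypothesis hmu : is_product_measure mu.
Variable q : nat -> R.
Hypothesis q0_gt0 : 0 < q 0%N.
Hypothesis q_ge0 : forall k, 0 <= q k.
Hypothesis q_noninc : nonincreasing_seq q.
Hypothesis Q_infty : Q q n @[n --> \oo] --> +oo.
Implicit Types (f g : vilenkin m -> R[i]).

Definition ae_cvg f : Prop :=
  L1 mu f /\ {ae mu, forall x, T_mean_cvg mu q f x}.

Lemma ae_cvgD f g : ae_cvg f -> ae_cvg g -> ae_cvg (fun x => f x + g x).
Proof.
move=> [f1 cf] [g1 cg]; split; first exact: L1D.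
by apply: filterS2 cf cg => x; exact: T_mean_cvgD.
Qed.

Lemma ae_cvgZ f c : ae_cvg f -> ae_cvg (fun x => f x * c).
Proof.
move=> [f1 cf]; split; first exact: L1Z.
by apply: filterS cf => x; exact: T_mean_cvgZ.
Qed.

Lemma measurable_norm1_ge f (e : R) : L1 mu f ->
  measurable [set x | e <= norm1 f x].
Proof.
move=> /measurable_norm1 /measurable_EFinP mn.
have := mn measurableT _ (measurable_itv `[e, +oo[).
rewrite setTI; congr measurable.
by apply/seteqP; split=> x; rewrite /= in_itv /= andbT.
Qed.

Lemma markov_norm1 f (e : R) : L1 mu f -> 0 <= e ->
  (e%:E * mu [set x | (e <= norm1 f x)%R] <= \int[mu]_x (norm1 f x)%:E)%E.
Proof.
move=> f1 e0; have mn := measurable_norm1 f1.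
have mS := measurable_norm1_ge e f1.
have n0 x : (0 <= (norm1 f x)%:E)%E by rewrite lee_fin addr_ge0.
rewrite -integral_cst //.
apply: (@le_trans _ _ (\int[mu]_(x in [set x | (e <= norm1 f x)%R]) (norm1 f x)%:E)%E).
  by apply: ge0_le_integral => //; exact: measurable_funTS.
exact: ge0_subset_integral.
Qed.

(** Off a small set, replacing [f] by a good [g] close to it in [L1] moves all
    the means, and the limit, by little. *)
Lemma ae_cvg_closed f : L1 mu f ->
  (forall eta : R, 0 < eta -> exists g, ae_cvg g /\
     (\int[mu]_x (norm1 (fun x => f x + g x * -1) x)%:E <= eta%:E)%E) ->
  ae_cvg f.
Proof.
move=> f1 approx; split=> //.
pose bad (e : R) : set (vilenkin m) := [set x | ~ exists N, forall n, (N <= n)%N ->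
  normc (T_mean mu q f n x - f x) <= e].
suff bad0 e : 0 < e -> mu.-negligible (bad e).
  have nU : mu.-negligible (\bigcup_i bad (i.+1%:R^-1)).
    by apply: negligible_bigcup => i; apply: bad0; rewrite invr_gt0.
  apply: negligibleS nU => x.
  move=> /= /existsNP[e /not_implyP[e0 eN]].
  have [i ie] := ltr_add_invr e0; rewrite add0r in ie.
  exists i => // -[N HN]; apply: eN; exists N => n /HN /le_trans; apply; exact: ltW.
move=> e0; apply: negligible_small => delta d0.
pose c : R := (48 * B ^ 4)%:R.
have c1 : 1 <= c.
  by rewrite (ler_nat _ 1) muln_gt0 expn_gt0 (leq_trans _ (m_leB 0)) // ltnW.
have c0 : 0 < c by rewrite (lt_le_trans ltr01).
(* At this height the maximal function of the error [h] stays below [e / 3] off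
   a set whose measure [eta] keeps below [delta / 2]. *)
pose lam := e / (3 * c).
have lam0 : 0 < lam by rewrite divr_gt0 ?mulr_gt0.
have lame : lam <= e / 3.
  by rewrite /lam ler_pM2l // lef_pV2 ?posrE ?mulr_gt0 // ler_peMr.
pose eta := delta * lam / 18.
have eta0 : 0 < eta by apply: divr_gt0; [exact: mulr_gt0|lra].
have [g [[g1 cg] fg]] := approx _ eta0.
pose h x := f x + g x * -1.
have h1 : L1 mu h by apply: L1D => //; exact: L1Z.
have [E [mE muE xE]] := fejer_maximal_inequality m_gt1 m_leB hmu h1 (ltW lam0).
have [Z [mZ muZ gZ]] := cg.
have e3 : 0 < e / 3 by rewrite divr_gt0.
have mS := measurable_norm1_ge (e / 3) h1.
have half (a : R) (S : set (vilenkin m)) : measurable S -> lam <= a ->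
    (a%:E * mu S <= 9%:E * \int[mu]_x (norm1 h x)%:E)%E -> (mu S <= (delta / 2)%:E)%E.
  move=> mS' la aS; have fS : mu S \is a fin_num by exact: fin_num_measure.
  have : (a%:E * mu S <= 9%:E * eta%:E)%E.
    by rewrite (le_trans aS) // lee_wpmul2l ?lee_fin.
  rewrite -(fineK fS) -!EFinM !lee_fin => aeta.
  have S0 : 0 <= fine (mu S) by rewrite fine_ge0.
  rewrite -(ler_pM2l lam0) (le_trans (ler_wpM2r S0 la)) // (le_trans aeta) //.
  by rewrite /eta le_eqVlt; apply/orP; left; apply/eqP; field.
have mu1 := half _ _ mE (lexx _) muE.
have mu2 : (mu [set x | (e / 3 <= norm1 h x)%R] <= (delta / 2)%:E)%E.
  apply: (half _ _ mS lame); rewrite (le_trans (markov_norm1 h1 (ltW e3))) //.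
  by rewrite lee_pemull ?lee_fin ?ler1n // integral_ge0 // => x _; rewrite lee_fin addr_ge0.
exists (E `|` [set x | e / 3 <= norm1 h x] `|` Z); split.
- by apply: measurableU => //; exact: measurableU.
- move=> x badx; apply: contrapT => /not_orP[/not_orP[Ex Sx] Zx]; apply: badx.
  have gx : T_mean_cvg mu q g x by apply: contrapT => ngx; apply/Zx/gZ.
  have [N HN] := gx _ e3; exists N => n Nn.
  have fE : f = (fun x => h x + g x) by apply/funext => y; rewrite /h; ring.
  rewrite {1}fE T_meanD // (_ : f x = h x + g x); last by rewrite /h; ring.
  rewrite opprD addrACA (le_trans (normcD _ _)) //.
  have Th : normc (T_mean mu q h n x) <= e / 3.
    apply: normc_T_mean_le => //; first exact: ltW.
    have clam : c * lam = e / 3 by rewrite /lam invfM mulrCA [c * _]mulrCA divff ?mulr1 // gt_eqF.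
    by move=> k; rewrite -clam; exact: xE.
  have hx : normc (h x) <= e / 3.
    by rewrite (le_trans (normc_le_ReIm _)) // leNgt; apply/negP => /ltW.
  have := normcD (T_mean mu q h n x) (- h x); rewrite normcN.
  have := HN n Nn; lra.
- set S := [set x | _] in mS mu2 *.
  apply: (@le_trans _ _ (mu (E `|` S) + mu Z)%E).
    by apply: measureU2 => //; exact: measurableU.
  rewrite muZ adde0; apply: (@le_trans _ _ (mu E + mu S)%E); first exact: measureU2.
  rewrite [delta]splitr EFinD.
  exact: leeD.
Qed.

Lemma norm1_cindicB (A C : set (vilenkin m)) : C `<=` A ->
  norm1 (fun x => cindic R A x + cindic R C x * -1) = \1_(A `\` C) :> (_ -> R).
Proof.
move=> CA; apply/funext => x; rewrite /norm1 complex_ReD complex_ImD complex_ReM complex_ImM /=.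
rewrite !(mulr0, mul0r, mulrN1, subr0, oppr0, addr0) normr0 addr0 !indicE in_setD.
have [xC|xC] := boolP (x \in C).
  by rewrite (mem_set (CA _ (set_mem xC))) subrr normr0.
by rewrite subr0 andbT ger0_norm.
Qed.

Lemma ae_cvg_rectangle N (A : forall k : nat, {set 'Z_(m k)}) :
  ae_cvg (cindic R (rectangle N A)).
Proof.
split; last by apply: aeW => x; exact: T_mean_cvg_rectangle.
apply: bounded_measurable_L1; apply: bounded_measurable_cindic.
exact: measurable_rectangle.
Qed.

Let rectangles : set (set (vilenkin m)) :=
  [set X | exists N A, X = rectangle N A].

Lemma setI_closed_rectangles : setI_closed rectangles.
Proof.
move=> _ _ [N [A ->]] [N' [A' ->]]; exists (maxn N N').
exists (fun k => ((if (k < N)%N then A k else [set: 'Z_(m k)]%SET) :&: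
  (if (k < N')%N then A' k else [set: 'Z_(m k)]%SET))%SET).
apply/seteqP; split=> [x [xA xA'] k _|x xAA'].
  rewrite inE; apply/andP; split; case: ifP; rewrite ?inE // => kN.
    exact: xA.
  exact: xA'.
by split=> k kN; have := xAA' k; rewrite leq_max kN ?orbT inE => /(_ isT) /andP[].
Qed.

(** Differences are covered by linearity and increasing unions by
    [ae_cvg_closed], so that Dynkin's theorem applies to the rectangles. *)
Lemma ae_cvg_cindic (A : set (vilenkin m)) : measurable A -> ae_cvg (cindic R A).
Proof.
pose H := [set X : set (vilenkin m) | measurable X /\ ae_cvg (cindic R X)].
suff HA : <<s setT, rectangles>> `<=` H.
  move=> mA; suff /HA[] : <<s setT, rectangles>> A by [].
  apply: smallest_sub mA; first exact: smallest_sigma_algebra.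
  move=> _ [k [C ->]]; apply: sub_sigma_algebra; exists k.+1.
  (* Comparing values as integers avoids transporting [C] along [l = k]. *)
  exists (fun l => [set a : 'Z_(m l) | (l == k) ==> [exists b in C, (b : nat) == a]]%SET).
  apply/seteqP; split=> [x xC l _|x xC].
    rewrite inE; apply/implyP => /eqP lk; subst l.
    by apply/exists_inP; exists (x k).
  have := xC k (ltnSn k); rewrite inE eqxx => /exists_inP[b bC /eqP/val_inj bx].
  by rewrite /= -bx.
apply: lambda_system_subset => //; first exact: setI_closed_rectangles.
- split => //.
  + split=> //; rewrite (_ : setT = rectangle 0 (fun k => [set: 'Z_(m k)]%SET)).
      exact: ae_cvg_rectangle.
    by apply/seteqP; split.
  + move=> X Y YX [mX cX] [mY cY]; split; first exact: measurableD.
    rewrite (_ : cindic R (X `\` Y) = fun x => cindic R X x + cindic R Y x * -1).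
      by apply: ae_cvgD => //; exact: ae_cvgZ.
    apply/funext => x; rewrite /cindic -(rmorphN1 (real_complex R)) -rmorphM -rmorphD /=.
    congr (_%:C)%C; rewrite !indicE in_setD mulrN1.
    have [xY|xY] := boolP (x \in Y); last by rewrite subr0 andbT.
    by rewrite (mem_set (YX _ (set_mem xY))) subrr.
  + move=> F ndF HF; have mF i : measurable (F i) by case: (HF i).
    have mU : measurable (\bigcup_i F i) by exact: bigcupT_measurable.
    split=> //; apply: ae_cvg_closed.
      by apply: bounded_measurable_L1; exact: bounded_measurable_cindic.
    move=> eta eta0; apply: contrapT => none.
    (* Otherwise all [F i] stay at distance [eta] from their union. *)
    have gap i : (mu (F i) <= mu (\bigcup_i F i) - eta%:E)%E.
      have FU : F i `<=` \bigcup_i F i by exact: bigcup_sup.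
      rewrite leNgt; apply/negP => lt; apply: none; exists (cindic R (F i)).
      have close : (mu (\bigcup_i F i) - mu (F i) <= eta%:E)%E.
        move: lt; rewrite -(fineK (fin_num_measure mu _ mU)).
        by rewrite -(fineK (fin_num_measure mu _ (mF i))) -!EFinB lte_fin lee_fin; lra.
      split; first by case: (HF i).
      rewrite norm1_cindicB // integral_indic //; last exact: measurableD.
      by rewrite setIT measureD // ?setIidr // ltey_eq fin_num_measure.
    have : (mu (\bigcup_i F i) <= mu (\bigcup_i F i) - eta%:E)%E.
      apply: (cvge_to_le (nondecreasing_cvg_mu mF mU ndF)).
      by apply: nearW => i; exact: gap.
    rewrite -(fineK (fin_num_measure mu _ mU)) -EFinB lee_fin; lra.
- by move=> _ [N [C ->]]; split; [exact: measurable_rectangle|exact: ae_cvg_rectangle].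
Qed.

Lemma ae_cvg_sum (I : Type) (r : seq I) (f : I -> vilenkin m -> R[i]) :
  (forall i, ae_cvg (f i)) -> ae_cvg (fun x => \sum_(i <- r) f i x).
Proof.
move=> cf; elim: r => [|i r IH].
  rewrite (_ : (fun x => _) = fun x => cindic R setT x * 0).
    by apply: ae_cvgZ; exact: ae_cvg_cindic.
  by apply/funext => x; rewrite big_nil mulr0.
rewrite (_ : (fun x => _) = fun x => f i x + \sum_(j <- r) f j x).
  exact: ae_cvgD.
by apply/funext => x; rewrite big_cons.
Qed.

Lemma ae_cvg_real (a : vilenkin m -> R) : mu.-integrable setT (EFin \o a) ->
  ae_cvg (fun x => (a x)%:C%C).
Proof.
move=> ia; have [s [_ _ sa]] := approximation_sfun_integrable measurableT ia.
have cs n : ae_cvg (fun x => (s n x)%:C%C).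
  rewrite (_ : (fun x => _) = fun x => \sum_(y <- finmap.enum_fset (fset_set (range (s n))))
      cindic R (s n @^-1` [set y]) x * y%:C%C).
    by apply: ae_cvg_sum => y; apply: ae_cvgZ; exact: ae_cvg_cindic.
  apply/funext => x; rewrite {1}fimfunE fsbig_finite //= rmorph_sum.
  by apply: eq_bigr => y _; rewrite rmorphM mulrC.
apply: ae_cvg_closed => [|eta eta0].
  by split=> //=; exact: integrable0.
apply: contrapT => none.
have gap n : (eta%:E <= \int[mu]_x `|(a x)%:E - (s n x)%:E|)%E.
  rewrite leNgt; apply/negP => lt; apply: none; exists (fun x => (s n x)%:C%C).
  split=> //; rewrite (le_trans _ (ltW lt)) // le_eqVlt; apply/orP; left; apply/eqP.
  apply: eq_integral => x _; rewrite /norm1 complex_ReD complex_ImD complex_ReM complex_ImM /=.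
  by rewrite !(mulr0, mul0r, mulrN1, subr0, oppr0, addr0) normr0 addr0.
have : (eta%:E <= 0)%E.
  by apply: (cvge_to_ge sa); apply: nearW => n; exact: gap.
by rewrite lee_fin leNgt eta0.
Qed.

Lemma L1_ae_cvg f : L1 mu f -> ae_cvg f.
Proof.
move=> [f1 f2]; rewrite (_ : f = fun x =>
    (complex.Re (f x))%:C%C + (complex.Im (f x))%:C%C * 'i%C).
  by apply: ae_cvgD; [|apply: ae_cvgZ]; exact: ae_cvg_real.
by apply/funext => x; rewrite {1}[f x]complexE mulrC.
Qed.

End AlmostEverywhere.

Lemma T_mean_cvgP (R : realType) (m : nat -> nat) (mu : probability (vilenkin m) R)
    (q : nat -> R) (f : vilenkin m -> R[i]) x : T_mean_cvg mu q f x ->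
  (T_mean mu q f n x : R[i]^o) @[n --> \oo] --> (f x : R[i]^o).
Proof.
move=> cf; apply/cvgrPdist_le => e e0.
have eR : e = (complex.Re e)%:C%C by rewrite RRe_real // gtr0_real.
have [N HN] : exists N, forall n, (N <= n)%N ->
    normc (T_mean mu q f n x - f x) <= complex.Re e.
  by apply: cf; rewrite -ltcR -eR.
exists N => // n /= /HN; rewrite -lecR -eR normcE distrC.
exact.
Qed.

(* [hQ] is the regularity condition of the summability method: without it the
   conclusion already fails for [q = (1, 0, 0, ...)], for which every mean of
   positive index is [partial_sum f 0 = 0], so for [f = 1]. *)
Theorem corollary2 (R : realType) (m : nat -> nat)
    (hm : bounded_vilenkin m)
    (mu : probability (vilenkin m) R) (hmu : is_product_measure mu)
    (q : nat -> R)
    (hq0 : 0 < q 0%N) (hq_ge0 : forall k, 0 <= q k)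
    (hq_noninc : nonincreasing_seq q)
    (hQ : Q q n @[n --> \oo] --> +oo)
    (f : vilenkin m -> R[i]) (hf : L1 mu f) :
  {ae mu, forall x : vilenkin m,
    (T_mean mu q f n x : R[i]^o) @[n --> \oo] --> (f x : R[i]^o)}.
Proof.
case: hm => m_gt1 [B m_leB].
have [_ cf] := L1_ae_cvg m_gt1 m_leB hmu hq0 hq_ge0 hq_noninc hQ hf.
by apply: filterS cf => x; exact: T_mean_cvgP.
Qed.
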